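(* Let $(M,h)$ be a Riemannian manifold of dimension $n\ge 3$, let $\varphi\in C^\infty(M)$ and let $\hat h=e^{2\varphi}h$. Let $g_+$ be an even Poincaré metric in normal form relative to $h$ on $M_+^\circ$. Let $\kappa$ be a diffeomorphism of $M_+$ which restricts to the identity on $M=\{0\}\times M$ and for which the (even) Poincaré metric $\hat g_+=\kappa^*(g_+)$ is in normal form relative to $\hat h$. Then for all $\lambda\in\mathbb C$ $$S(\hat g_+;\lambda)=\kappa^*\circ\left(\frac{\kappa_*(r)}{r}\right)^{\lambda-n}\circ S(g_+;\lambda)\circ\left(\frac{\kappa_*(r)}{r}\right)^{n-\lambda-1}\circ\kappa_* .$$
   Context: Setting. $M_+=[0,\varepsilon)\times M$ with coordinate $r$ on the first factor, $M_+^\circ=(0,\varepsilon)\times M$, $\iota:M\to M_+$, $\iota(m)=(0,m)$. An even Poincaré metric in normal form relative to $h$ is a metric $g_+=r^{-2}(dr^2+h_r)$ on $M_+^\circ$, where $h_r$ is a one-parameter family of metrics on $M$, smooth up to $r=0$, with $h_0=h$ and with only even powers of $r$ in its Taylor series at $r=0$, such that: for odd $n$, $\operatorname{Ric}(g_+)+ng_+=O(r^\infty)$; for even $n$, $\operatorname{Ric}(g_+)+ng_+=O(r^{n-2})$ and $\operatorname{tr}_h(\iota^*(r^{-n+2}(\operatorname{Ric}(g_+)+ng_+)))=0$. Put $\bar g=r^2g_+=dr^2+h_r$, a metric on $M_+$. Laplacians are non-positive: $\Delta=-\delta d$. The shift operator is the second-order differential operator $$S(g_+;\lambda)=r\Delta_{\bar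 g}-(2\lambda-n+1)\partial_r-\tfrac12(\lambda-n+1)\operatorname{tr}(h_r^{-1}\dot h_r),\qquad \lambda\in\mathbb C,$$ where the dot denotes $\partial/\partial r$. The operator $S(\hat g_+;\lambda)$ is defined in the same way from $\hat g_+=r^{-2}(dr^2+\hat h_r)$, $\hat h_0=\hat h$. Here $\kappa^*$ is pull-back of functions, $\kappa_*=(\kappa^{-1})^*$, and functions act as multiplication operators. *)

(* Defs.v *)
From HB Require Import structures.
From mathcomp Require Import all_boot all_order all_algebra.
From mathcomp Require Import all_classical all_reals all_analysis.
From mathcomp Require Import complex.

Set Implicit Arguments.
Unset Strict Implicit.
Unset Printing Implicit Defensive.

Import Order.TTheory GRing.Theory Num.Theory.
Import numFieldNormedType.Exports.

Local Open Scope classical_set_scope.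
Local Open Scope ring_scope.
Local Open Scope complex_scope.

(* Calculus on a set D of row vectors. D is always open in R^m or relatively
   open in the half-space { y_0 >= 0 }: derivatives are ordinary ones at
   interior points and one-sided, taken from inside D, at boundary points. *)
Section Calculus.
Variables (R : realType) (m : nat).
Implicit Types (D : set 'rV[R]_m) (f : 'rV[R]_m -> R).

Definition diffquot f (a : 'I_m) (x : 'rV[R]_m) (t : R) : R :=
  (f (x + t *: delta_mx 0 a) - f x) / t.

Definition steps D (a : 'I_m) (x : 'rV[R]_m) : set_system R :=
  within [set t | D (x + t *: delta_mx 0 a)] 0^'.

Definition pd D (a : 'I_m) f (x : 'rV[R]_m) : R :=
  lim (diffquot f a x @ steps D a x).

Fixpoint Ck (k : nat) D f : Prop :=
  {within D, continuous f} /\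
  if k is k'.+1 then
    forall a, (forall x, D x -> cvg (diffquot f a x @ steps D a x)) /\
              Ck k' D (pd D a f)
  else True.

Definition Cinfty D f : Prop := forall k, Ck k D f.

Definition jacobian D (p : nat) (F : 'rV[R]_m -> 'rV[R]_p) (x : 'rV[R]_m)
    : 'M[R]_(m, p) :=
  \matrix_(a, b) pd D a (fun y => F y 0 b) x.

(* Riemannian geometry of a metric with component matrix G on D. *)
Variables (D : set 'rV[R]_m) (G : 'rV[R]_m -> 'M[R]_m).

(* christoffel c a b is $\Gamma^c_{ab}$ *)
Definition christoffel (c a b : 'I_m) (x : 'rV[R]_m) : R :=
  2^-1 * \sum_d invmx (G x) c d *
    (pd D a (fun y => G y b d) x + pd D b (fun y => G y a d) x
     - pd D d (fun y => G y a b) x).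

(* positive on round spheres *)
Definition ricci (x : 'rV[R]_m) : 'M[R]_m :=
  \matrix_(a, b)
    (\sum_c (pd D c (christoffel c a b) x - pd D b (christoffel c a c) x)
     + \sum_c \sum_d (christoffel c c d x * christoffel d a b x
                      - christoffel c b d x * christoffel d a c x)).

(* $\delta\omega = - \nabla^a \omega_a$, the formal adjoint of d on 1-forms *)
Definition codiff (w : 'I_m -> 'rV[R]_m -> R) (x : 'rV[R]_m) : R :=
  - \sum_a \sum_b invmx (G x) a b *
      (pd D a (w b) x - \sum_c christoffel c a b x * w c x).

Definition laplacian f (x : 'rV[R]_m) : R := - codiff (fun a => pd D a f) x.

End Calculus.

(* Family of charts on (a subset of) T, with inverse parametrizations. The
   record carries data only; see is_manifold for the axioms. *)
Record atlas (R : realType) (T : topologicalType) (m : nat) := Atlas {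
  idx : Type;
  dom : idx -> set T;
  coord : idx -> T -> 'rV[R]_m;
  param : idx -> 'rV[R]_m -> T }.
Arguments dom {R T m} A i p : rename.
Arguments coord {R T m} A i p : rename.
Arguments param {R T m} A i x : rename.

Section Manifolds.
Variable R : realType.

Definition img (T : topologicalType) m (A : atlas R T m) (i : idx A)
  : set 'rV[R]_m := coord A i @` dom A i.
Arguments img {T m} A i x.

Definition pts (T : topologicalType) m (A : atlas R T m) : set T :=
  [set p | exists i : idx A, dom A i p].

Section Maps.
Variables (T U : topologicalType) (m p : nat).
Variables (A : atlas R T m) (B : atlas R U p) (F : T -> U).

Definition rep (i : idx A) (j : idx B) (x : 'rV[R]_m) : 'rV[R]_p :=
  coord B j (F (param A i x)).

Definition rep_dom (i : idx A) (j : idx B) : set 'rV[R]_m :=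
  [set x | img A i x /\ dom B j (F (param A i x))].

Definition smooth_map : Prop :=
  {within pts A, continuous F} /\
  forall i j b, Cinfty (rep_dom i j) (fun x => rep i j x 0 b).

End Maps.
Arguments rep {T U m p} A B F i j x.
Arguments rep_dom {T U m p} A B F i j x.

Definition diffeo (T : topologicalType) m (A : atlas R T m) (F G : T -> T) :=
  [/\ forall p, pts A p -> pts A (F p) /\ G (F p) = p,
      forall p, pts A p -> pts A (G p) /\ F (G p) = p,
      smooth_map A A F & smooth_map A A G].

Definition is_manifold (T : topologicalType) m (A : atlas R T m) : Prop :=
  [/\ hausdorff_space T,
      @second_countable T,
      pts A = setT,
      forall i : idx A,
        [/\ open (dom A i), open (img A i),
            forall p, dom A i p -> param A i (coord A i p) = p,
            {within dom A i, continuous (coord A i)} &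
            {within img A i, continuous (param A i)}] &
      smooth_map A A id].

Section Tensors.
Variables (T : topologicalType) (m : nat) (A : atlas R T m).

(* components of a covariant 2-tensor field in every chart *)
Definition tensor2 := idx A -> 'rV[R]_m -> 'M[R]_m.

Definition smooth_fun (f : T -> R) : Prop :=
  forall i : idx A, Cinfty (img A i) (f \o param A i).

Definition smooth_cfun (u : T -> R[i]) : Prop :=
  smooth_fun (fun p => complex.Re (u p)) /\
  smooth_fun (fun p => complex.Im (u p)).

(* g' = F^* g *)
Definition is_pullback (F : T -> T) (g g' : tensor2) : Prop :=
  forall (i j : idx A) x, rep_dom A A F i j x ->
    let J := jacobian (rep_dom A A F i j) (rep A A F i j) x in
    g' i x = J *m g j (rep A A F i j x) *m J^T.

Definition is_metric (g : tensor2) : Prop :=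
  [/\ forall i a b, Cinfty (img A i) (fun x => g i x a b),
      forall i x, img A i x -> (g i x)^T = g i x,
      forall i x, img A i x ->
        forall v : 'rV[R]_m, v != 0 -> 0 < (v *m g i x *m v^T) 0 0 &
      is_pullback id g g].

(* e^{2 phi} h *)
Definition conformal (phi : T -> R) (h : tensor2) : tensor2 :=
  fun i x => expR (2 * phi (param A i x)) *: h i x.

End Tensors.
Arguments is_pullback {T m} A F g g'.

(* The product J x M, with coordinates (r, x) of type 'rV_(1 + n). *)
Definition cyl (J : set R) (T : topologicalType) n (M : atlas R T n)
    : atlas R (R * T)%type (1 + n) :=
  @Atlas R (R * T)%type (1 + n) (idx M)
    (fun i p => J p.1 /\ dom M i p.2)
    (fun i p => row_mx (const_mx p.1) (coord M i p.2))
    (fun i y => (lsubmx y 0 0, param M i (rsubmx y))).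

Section Poincare.
Variables (T : topologicalType) (n : nat) (M : atlas R T n).
Variable eps : R.

Definition Mplus := cyl `[0, eps[ M.
Definition Mplus0 := cyl `]0, eps[ M.

Definition rcoord (y : 'rV[R]_(1 + n)) : R := lsubmx y 0 0.
Definition bdry (x : 'rV[R]_n) : 'rV[R]_(1 + n) := row_mx (0 : 'rV[R]_1) x.
Definition dr : 'I_(1 + n) := lshift n ord0.

Section Metrics.
Variable hr : R -> tensor2 M.

Definition hcomp (i : idx M) (y : 'rV[R]_(1 + n)) : 'M[R]_n :=
  hr (rcoord y) i (rsubmx y).

Definition gbar : tensor2 Mplus :=
  fun i y => block_mx 1%:M 0 0 (hcomp i y).

Definition gplus : tensor2 Mplus0 :=
  fun i y => (rcoord y) ^- 2 *: block_mx 1%:M 0 0 (hcomp i y).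

(* Ric(g_+) + n g_+ *)
Definition einstein : tensor2 Mplus0 :=
  fun i y => ricci (img Mplus0 i) (gplus i) y + n%:R *: gplus i y.

(* Filter of points of the interior, in the chart i, tending to (0, x). *)
Definition to_bdry (i : idx M) (x : 'rV[R]_n) : set_system 'rV[R]_(1 + n) :=
  within (img Mplus0 i) (nbhs (bdry x)).

(* E = O(r^k), locally uniformly up to the boundary *)
Definition bigO_r (k : nat) (E : tensor2 Mplus0) : Prop :=
  forall (i : idx M) x, img M i x -> exists C : R,
    \forall y \near to_bdry i x,
      forall a b, `|E i y a b| <= C * rcoord y ^+ k.

(* tr_h (iota^* (r^{-k} E)) = 0; iota^* is the tangential block of the
   boundary value. *)
Definition trace_free_bdry (h : tensor2 M) (k : nat) (E : tensor2 Mplus0) :=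
  forall (i : idx M) x, img M i x -> exists2 L : 'M[R]_n,
    (rcoord y ^- k *: (drsubmx (E i y) : 'M[R]_n)) @[y --> to_bdry i x] --> L
    & \tr (invmx (h i x) *m L) = 0.

(* g_+ = r^{-2}(dr^2 + h_r) is an even Poincare metric in normal form
   relative to h. *)
Definition even_poincare (h : tensor2 M) : Prop :=
  [/\ forall r, 0 <= r < eps -> is_metric (hr r),
      forall i a b, Cinfty (img Mplus i) (fun y => hcomp i y a b),
      forall i x, img M i x -> hr 0 i x = h i x,
      forall (i : idx M) x a b k, img M i x ->
        iter k.*2.+1 (pd (img Mplus i) dr)
          (fun y => hcomp i y a b) (bdry x) = 0 &
      if odd n then forall k, bigO_r k einstein
      else bigO_r (n - 2) einstein /\ trace_free_bdry h (n - 2) einstein].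

(* The operator S(g_+; lambda) on complex functions on M_+, computed in the
   chart i: the value at p is meaningful when p lies in the domain of i, and
   does not depend on i. *)
Definition shift_op (i : idx M) (lam : R[i]) (u : R * T -> R[i])
    (p : R * T) : R[i] :=
  let D := img Mplus i in
  let y := coord Mplus i p in
  let u1 z := complex.Re (u (param Mplus i z)) in
  let u2 z := complex.Im (u (param Mplus i z)) in
  let dhr := \matrix_(a, b) pd D dr (fun z => hcomp i z a b) y in
  (p.1)%:C * (laplacian D (gbar i) u1 y +i* laplacian D (gbar i) u2 y)
  - (2 * lam - n%:R + 1) * (pd D dr u1 y +i* pd D dr u2 y)
  - 2^-1 * (lam - n%:R + 1) * (\tr (invmx (hcomp i y) *m dhr))%:C * u p.

End Metrics.

End Poincare.

(* a^s for real a > 0 and complex s *)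
Definition cpow (a : R) (s : R[i]) : R[i] :=
  (expR (complex.Re s * ln a))%:C *
  (cos (complex.Im s * ln a) +i* sin (complex.Im s * ln a)).

Section Operators.
Variable T : topologicalType.
Implicit Types (f : R * T -> R) (u w : R * T -> R[i]).

(* f / r for f vanishing on r = 0, extended by continuity to r = 0 *)
Definition div_r f (p : R * T) : R :=
  if p.1 == 0 then lim (f (t, p.2) / t @[t --> 0^'+]) else f p / p.1.

Definition pull (F : R * T -> R * T) u : R * T -> R[i] := u \o F.

Definition mult w u : R * T -> R[i] := fun p => w p * u p.

End Operators.

End Manifolds.

Arguments img {R T m} A i x.
Arguments rep {R T U m p} A B F i j x.
Arguments rep_dom {R T U m p} A B F i j x.
Arguments is_pullback {R T m} A F g g'.
Arguments gbar {R T n M} eps hr i y.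
Arguments gplus {R T n M} eps hr i y.
Arguments einstein {R T n M} eps hr i y.

(* Main.v *)
(** Put [s = n - lambda - 1] and [F = kappa^-1], so that [g_+ = F^* hat g_+].
    Since [bar g = dr^2 + h_r] gives [|dr| = 1] and
    [Delta r = tr (h_r^-1 dh_r/dr) / 2], the shift operator is
    [r Delta + (2 s - n + 1) <dr, .> + s (Delta r)], an expression which is
    natural in [(bar g, r)].  Let [f = F^* r], [rho = f / r] and [L = log rho].
    Then [F^* (bar hat g) = rho^2 bar g], and for [r > 0] the theorem follows
    from the conformal transformation law of the Laplacian and from
    [2 <dr, dL> + r |dL|^2 = 0], which is [|df| = 1] in the metric
    [F^* (bar hat g)].

    At [r = 0] only the first-order term of the operator survives, because
    evenness kills the trace.  There, in the limit [r -> 0], the identity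
    [F^* (bar hat g) = rho^2 bar g] forces the tangential part [c] of
    [dF (d/dr)] to vanish and gives [(df/dr)^2 - rho^2 = - |c|^2 = O(r^2)].
    Hence [d rho / dr = (df/dr - rho) / r] tends to [0], the factor [rho^s] is
    not differentiated, and [d/dr] pulls back to [rho d/dr]. *)

Require Import Defs.
From mathcomp Require Import all_boot all_order all_algebra.
From mathcomp Require Import all_classical all_reals all_analysis.
From mathcomp Require Import complex ring lra.

Import Order.TTheory GRing.Theory Num.Theory.
Import numFieldNormedType.Exports.
Local Open Scope classical_set_scope.
Local Open Scope ring_scope.
Local Open Scope complex_scope.

Set Implicit Arguments.
Unset Strict Implicit.

(** * Pointwise transformation laws of the Laplacian *)

(** At a point, the Laplacian sees one derivative of the metric and two of the function. The
    interior argument is therefore rational algebra in finite jets over a field: the Jacobian and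
    the second derivatives of $F$ are symbols tied only by the metric identity and its first
    derivative, and the complex power enters only through $d(\rho^s) = s\rho^s\,dL$. The target is
    $S(g_+)\circ\rho^s = \rho^{s+1}\,\hat S$ after pull-back; the additional $\rho$ arises because
    $r$ becomes $f = \rho r$ while the Laplacian acquires $\rho^{-2}$.

    The analytic obstacle is the boundary. Derivatives there are one-sided, and $C^k$ means
    existence and continuity of iterated partial derivatives, so the chain rule has to come from
    mean values along the axes. The pull-back of the singular metric is given only for $r>0$, so
    each fact at $r=0$ is a limit along the $r$-axis. Moreover $\rho$ is a quotient with no
    regularity given at $r=0$; instead of smoothness up to the boundary, only its $r$-derivative
    there is established. *)

Section Algebra.
Variables (K : fieldType) (m : nat).
Implicit Types (G Gi J hG hGi Hi : 'M[K]_m) (dG dhG dH : 'I_m -> 'M[K]_m).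
Implicit Types (p L hp hL : 'I_m -> K) (q hq : 'I_m -> 'I_m -> K).

(** A metric near a point enters through its inverse [Gi] and its first
    derivatives [dG a], a function through its derivatives [p a] and [q a b].
    [low_chr] is twice the Christoffel symbol of the first kind. *)
Definition low_chr dG d a b : K := dG a b d + dG b a d - dG d a b.

Definition chr Gi dG c a b : K := 2^-1 * \sum_d Gi c d * low_chr dG d a b.

Definition plap Gi dG p q : K :=
  \sum_a \sum_b Gi a b * (q a b - \sum_c chr Gi dG c a b * p c).

Definition pdot Gi p L : K := \sum_a \sum_b Gi a b * (p a * L b).

Lemma pdotC Gi p L : Gi^T = Gi -> pdot Gi p L = pdot Gi L p.
Proof.
move=> GiT; rewrite /pdot exchange_big; apply: eq_bigr => a _.
by apply: eq_bigr => b _; rewrite -{1}GiT mxE [p b * _]mulrC.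
Qed.

Lemma pdot_ext Gi p p' L L' : p =1 p' -> L =1 L' -> pdot Gi p L = pdot Gi p' L'.
Proof.
by move=> pp LL; apply: eq_bigr => a _; apply: eq_bigr => b _; rewrite pp LL.
Qed.

Lemma plap_ext Gi dG p p' q q' : p =1 p' -> q =2 q' ->
  plap Gi dG p q = plap Gi dG p' q'.
Proof.
move=> pp qq; apply: eq_bigr => a _; apply: eq_bigr => b _; rewrite qq.
by congr (_ * (_ - _)); apply: eq_bigr => c _; rewrite pp.
Qed.

Lemma sum_mul1r G Gi a (X : 'I_m -> K) : G *m Gi = 1%:M ->
  \sum_b \sum_c G a b * Gi b c * X c = X a.
Proof.
move=> GGi; have del c : \sum_b G a b * Gi b c = (a == c)%:R.
  by have := congr1 (fun A : 'M[K]_m => A a c) GGi; rewrite !mxE.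
rewrite exchange_big /= (bigD1 a) //= -mulr_suml del eqxx mul1r.
rewrite big1 ?addr0 // => c /negPf ca.
by rewrite -mulr_suml del eq_sym ca mul0r.
Qed.

(** With [k] $= e^{2w}$ and [L] $= dw$, the hypothesis on [dH] is the product rule for $e^{2w}G$.
    The symbols are linear in the first derivatives, so only the $dw$ terms are new, and [k] cancels
    against the inverse metric. *)
Lemma chr_conformal G Gi dG dH L (k : K) c a b :
  (2 : K) != 0 -> k != 0 -> Gi *m G = 1%:M -> G^T = G ->
  (forall a, dH a = k *: (dG a + (2 * L a) *: G)) ->
  chr (k^-1 *: Gi) dH c a b = chr Gi dG c a b + (c == b)%:R * L a
    + (c == a)%:R * L b - G a b * \sum_d Gi c d * L d.
Proof.
move=> nz2 nzk GiG GT dHE; have GE i j : G i j = G j i by rewrite -{1}GT mxE.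
have del i j : \sum_d Gi i d * G d j = (i == j)%:R.
  by have := congr1 (fun A : 'M[K]_m => A i j) GiG; rewrite !mxE.
rewrite -(del c b) -(del c a) /chr !mulr_sumr !mulr_suml -!big_split /=.
rewrite -sumrB; apply: eq_bigr => d _.
rewrite /low_chr !dHE !mxE (GE d b) (GE d a).
by field; rewrite nz2 nzk.
Qed.

(** When the change of the Christoffel symbols is contracted with the inverse metric, the two
    Kronecker terms contribute $-2\langle L,p\rangle$ and the term with [G] contributes its trace
    $m$ times $\langle L,p\rangle$. *)
Lemma plap_conformal G Gi dG dH L p q (k : K) :
  (2 : K) != 0 -> k != 0 -> Gi *m G = 1%:M -> G^T = G -> Gi^T = Gi ->
  (forall a, dH a = k *: (dG a + (2 * L a) *: G)) ->
  plap (k^-1 *: Gi) dH p q =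
  k^-1 * (plap Gi dG p q + (m%:R - 2) * pdot Gi L p).
Proof.
move=> nz2 nzk GiG GT GiT dHE.
pose X := \sum_c \sum_d Gi c d * L d * p c.
have XE : X = pdot Gi L p.
  rewrite pdotC //; apply: eq_bigr => a _; apply: eq_bigr => b _.
  by rewrite -mulrA [L b * _]mulrC.
have sumE a b : \sum_c chr (k^-1 *: Gi) dH c a b * p c =
    \sum_c chr Gi dG c a b * p c + L a * p b + L b * p a - G a b * X.
  have -> : L a * p b = \sum_c (c == b)%:R * L a * p c.
    rewrite (bigD1 b) //= eqxx mul1r big1 ?addr0 // => c /negPf->.
    by rewrite !mul0r.
  have -> : L b * p a = \sum_c (c == a)%:R * L b * p c.
    rewrite (bigD1 a) //= eqxx mul1r big1 ?addr0 // => c /negPf->.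
    by rewrite !mul0r.
  rewrite /X mulr_sumr -!big_split -sumrB /=; apply: eq_bigr => c _.
  rewrite (@chr_conformal G Gi dG dH L) // !mulrDl mulNr -mulrA; congr (_ - _).
  by rewrite -mulr_suml mulrA.
have trE : \sum_a \sum_b Gi a b * G a b = m%:R.
  transitivity (\tr (Gi *m G)); last by rewrite GiG mxtrace1.
  apply: eq_bigr => a _; rewrite mxE; apply: eq_bigr => b _.
  by rewrite -{1}GT mxE.
have -> : (m%:R - 2) * pdot Gi L p =
    (\sum_a \sum_b Gi a b * G a b) * X - pdot Gi L p - pdot Gi p L.
  by rewrite trE XE [pdot Gi p L]pdotC //; ring.
rewrite /plap /pdot !mulr_suml -!sumrB -!big_split mulr_sumr /=.
apply: eq_bigr => a _.
rewrite !mulr_suml -!sumrB -!big_split mulr_sumr /=.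
apply: eq_bigr => b _; rewrite mxE sumE; ring.
Qed.

Lemma pdot_pullback J Hi hGi p L hp hL : J^T *m Hi *m J = hGi ->
  (forall a, p a = \sum_k J a k * hp k) ->
  (forall a, L a = \sum_k J a k * hL k) ->
  pdot Hi p L = pdot hGi hp hL.
Proof.
move=> JHJ pE LE; rewrite /pdot -JHJ.
transitivity (\sum_a \sum_b \sum_k \sum_l (J a k * Hi a b * J b l) * (hp k * hL l)).
  apply: eq_bigr => a _; apply: eq_bigr => b _; rewrite pE LE mulr_suml mulr_sumr.
  apply: eq_bigr => k _; rewrite !mulr_sumr; apply: eq_bigr => l _; ring.
rewrite (eq_bigr _ (fun a _ => exchange_big _ _ _ _ _ _)) exchange_big /=.
apply: eq_bigr => k _.
rewrite (eq_bigr _ (fun a _ => exchange_big _ _ _ _ _ _)) exchange_big /=.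
apply: eq_bigr => l _; rewrite mxE mulr_suml exchange_big /=.
apply: eq_bigr => b _; rewrite mxE !mulr_suml; apply: eq_bigr => a _.
by rewrite mxE.
Qed.

(** The last hypothesis is the product rule for $J\hat GJ^T$. Of the six terms with second
    derivatives [C], four cancel in pairs by the symmetry of [C] and [hG]; the other two coincide
    and give the inhomogeneous term with its factor 2. *)
Lemma low_chr_pullback J hG dhG dH (C : 'I_m -> 'I_m -> 'I_m -> K) d a b :
  hG^T = hG -> (forall a b k, C a b k = C b a k) ->
  (forall a b d, dH a b d = \sum_k \sum_l
     (C a b k * hG k l * J d l + J b k * (\sum_e J a e * dhG e k l) * J d l
      + J b k * hG k l * C a d l)) ->
  low_chr dH d a b = \sum_l J d l *
    (2 * (\sum_k C a b k * hG k l)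
     + \sum_e \sum_k J a e * J b k * low_chr dhG l e k).
Proof.
move=> hGT CS dHE.
have hGE i j : hG i j = hG j i by rewrite -{1}hGT mxE.
pose B (x y : 'I_m -> K) := \sum_k \sum_l x k * hG k l * y l.
pose T (x y z : 'I_m -> K) := \sum_e \sum_k \sum_l x e * y k * z l * dhG e k l.
have BC x y : B x y = B y x.
  rewrite /B exchange_big; apply: eq_bigr => k _; apply: eq_bigr => l _.
  by rewrite hGE; ring.
have dHBT i j n : dH i j n = B (C i j) (J n) + T (J i) (J j) (J n) + B (J j) (C i n).
  rewrite dHE /B /T exchange_big /=.
  rewrite [X in _ = _ + X + _](_ : _ = \sum_k \sum_l \sum_e J i e * J j k * J n l * dhG e k l).
    rewrite [X in _ = X + _ + _]exchange_big [X in _ = _ + X + _]exchange_big.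
    rewrite [X in _ = _ + _ + X]exchange_big -!big_split; apply: eq_bigr => l _.
    rewrite -!big_split; apply: eq_bigr => k _ /=.
    congr (_ + _ + _); rewrite mulr_sumr mulr_suml; apply: eq_bigr => e _; ring.
  rewrite exchange_big; apply: eq_bigr => k _; rewrite exchange_big.
  by apply: eq_bigr => l _.
have -> : low_chr dH d a b = 2 * B (C a b) (J d)
    + (T (J a) (J b) (J d) + T (J b) (J a) (J d) - T (J d) (J a) (J b)).
  have e1 x : B (C b a) x = B (C a b) x.
    by apply: eq_bigr => k _; apply: eq_bigr => l _; rewrite CS.
  have e2 x : B x (C b d) = B x (C d b).
    by apply: eq_bigr => k _; apply: eq_bigr => l _; rewrite (CS b).
  have e3 x : B x (C a d) = B (C d a) x.
    by rewrite BC; apply: eq_bigr => k _; apply: eq_bigr => l _; rewrite (CS a).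
  rewrite /low_chr !dHBT e1 e2 e3; ring.
have -> : T (J b) (J a) (J d) =
    \sum_e \sum_k \sum_l J a e * J b k * J d l * dhG k e l.
  rewrite /T exchange_big; apply: eq_bigr => e _; apply: eq_bigr => k _.
  by apply: eq_bigr => l _; ring.
have -> : T (J d) (J a) (J b) =
    \sum_e \sum_k \sum_l J a e * J b k * J d l * dhG l e k.
  rewrite /T exchange_big; apply: eq_bigr => e _; rewrite exchange_big.
  by apply: eq_bigr => k _; apply: eq_bigr => l _; ring.
rewrite (eq_bigr _ (fun l _ => mulrDr _ _ _)) big_split /=; congr (_ + _).
  rewrite /B exchange_big mulr_sumr; apply: eq_bigr => l _.
  by rewrite !mulr_sumr; apply: eq_bigr => k _; ring.
rewrite /T -big_split -sumrB /= [RHS](_ : _ =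
    \sum_l \sum_e \sum_k J d l * (J a e * J b k * low_chr dhG l e k)).
  rewrite [RHS]exchange_big; apply: eq_bigr => e _; rewrite [RHS]exchange_big /=.
  rewrite -big_split -sumrB; apply: eq_bigr => k _.
  rewrite -big_split -sumrB; apply: eq_bigr => l _; rewrite /low_chr /=; ring.
apply: eq_bigr => l _; rewrite mulr_sumr; apply: eq_bigr => e _.
by rewrite mulr_sumr.
Qed.

(** The second derivatives [C] of the map occur both in the chain rule for the Hessian and in the
    inhomogeneous part of the Christoffel symbols. They cancel in the covariant Hessian, which
    therefore transforms as a tensor. *)
Lemma plap_pullback J Hi hG hGi dhG dH C p hp q hq :
  (2 : K) != 0 -> hG^T = hG -> hG *m hGi = 1%:M -> J^T *m Hi *m J = hGi ->
  (forall a b k, C a b k = C b a k) ->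
  (forall a b d, dH a b d = \sum_k \sum_l
     (C a b k * hG k l * J d l + J b k * (\sum_e J a e * dhG e k l) * J d l
      + J b k * hG k l * C a d l)) ->
  (forall a, p a = \sum_k J a k * hp k) ->
  (forall a b, q a b = \sum_k (C a b k * hp k + J b k * \sum_l J a l * hq l k)) ->
  plap Hi dH p q = plap hGi dhG hp hq.
Proof.
move=> nz2 hGT GGi JHJ CS dHE pE qE.
have hGiE n l : \sum_c \sum_d J c n * Hi c d * J d l = hGi n l.
  rewrite -JHJ !mxE exchange_big; apply: eq_bigr => d _.
  by rewrite mxE mulr_suml; apply: eq_bigr => c _; rewrite mxE.
have hGiT n l : hGi n l = hGi l n.
  have : hGi^T *m hG = 1%:M by rewrite -[1%:M]trmx1 -GGi trmx_mul hGT.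
  by move=> /(congr1 (mulmx^~ hGi)); rewrite -mulmxA GGi mulmx1 mul1mx => {2}<-; rewrite mxE.
have sumE a b : \sum_c chr Hi dH c a b * p c = \sum_k C a b k * hp k
    + \sum_e \sum_k J a e * J b k * \sum_c chr hGi dhG c e k * hp c.
  transitivity (2^-1 * \sum_n \sum_l hGi n l * hp n *
      (2 * (\sum_k C a b k * hG k l)
     + \sum_e \sum_k J a e * J b k * low_chr dhG l e k)).
    under [in RHS]eq_bigr do under eq_bigr do rewrite -hGiE.
    rewrite mulr_sumr.
    set Y := fun l => 2 * (\sum_k C a b k * hG k l)
      + \sum_e \sum_k J a e * J b k * low_chr dhG l e k.
    have chrE c : chr Hi dH c a b = 2^-1 * \sum_d Hi c d * \sum_l J d l * Y l.
      by congr (_ * _); apply: eq_bigr => d _; rewrite (low_chr_pullback d a b hGT CS dHE).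
    transitivity (\sum_c \sum_n \sum_l \sum_d 2^-1 * (J c n * Hi c d * J d l * hp n * Y l)).
      apply: eq_bigr => c _; rewrite chrE pE mulr_sumr; apply: eq_bigr => n _.
      rewrite mulr_sumr mulr_suml exchange_big; apply: eq_bigr => d _.
      rewrite !mulr_sumr mulr_suml; apply: eq_bigr => l _; rewrite /Y; ring.
    rewrite exchange_big; apply: eq_bigr => n _; rewrite mulr_sumr [LHS]exchange_big.
    apply: eq_bigr => l _; rewrite !mulr_suml [RHS]mulr_sumr; apply: eq_bigr => c _.
    by rewrite !mulr_suml [RHS]mulr_sumr; apply: eq_bigr => d _; rewrite /Y; ring.
  transitivity (\sum_n \sum_l hGi n l * hp n * (\sum_k C a b k * hG k l) +
     \sum_n \sum_l 2^-1 * (hGi n l * hp n * (\sum_e \sum_k J a e * J b k * low_chr dhG l e k))).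
    rewrite -big_split mulr_sumr; apply: eq_bigr => n _.
    by rewrite -big_split mulr_sumr; apply: eq_bigr => l _ /=; field.
  congr (_ + _).
    under [RHS]eq_bigr => k _ do
      rewrite -(sum_mul1r k (fun n => hp n) GGi) mulr_sumr.
    rewrite [RHS]exchange_big [LHS]exchange_big; apply: eq_bigr => l _ /=.
    under [RHS]eq_bigr do rewrite mulr_sumr.
    rewrite [RHS]exchange_big; apply: eq_bigr => n _.
    by rewrite mulr_sumr; apply: eq_bigr => k _; rewrite (hGiT n l); ring.
  transitivity (\sum_e \sum_k \sum_n \sum_l 2^-1 * (hGi n l * hp n * (J a e * J b k * low_chr dhG l e k))).
    under [RHS]eq_bigr do rewrite exchange_big.
    rewrite [RHS]exchange_big; apply: eq_bigr => n _.
    under [RHS]eq_bigr do rewrite exchange_big.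
    rewrite [RHS]exchange_big; apply: eq_bigr => l _.
    rewrite !mulr_sumr; apply: eq_bigr => e _.
    by rewrite !mulr_sumr; apply: eq_bigr => k _.
  apply: eq_bigr => e _; apply: eq_bigr => k _; rewrite mulr_sumr.
  apply: eq_bigr => n _; rewrite /chr mulr_sumr mulr_suml mulr_sumr.
  by apply: eq_bigr => l _; ring.
(* [F] is the covariant Hessian on the target side; what remains is its pull-back by [J], contracted
   with [Hi]. *)
pose F e k := hq e k - \sum_c chr hGi dhG c e k * hp c.
transitivity (\sum_a \sum_b \sum_e \sum_k (J a e * Hi a b * J b k) * F e k).
  apply: eq_bigr => a _; apply: eq_bigr => b _.
  rewrite sumE qE big_split /=.
  rewrite [X in _ * (_ + X - _)](_ : _ = \sum_e \sum_k J a e * J b k * hq e k).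
    rewrite opprD addrACA subrr add0r -sumrB mulr_sumr; apply: eq_bigr => e _.
    rewrite -sumrB mulr_sumr; apply: eq_bigr => k _; rewrite /F; ring.
  rewrite exchange_big; apply: eq_bigr => k _; rewrite mulr_sumr.
  by apply: eq_bigr => e _; ring.
under eq_bigr do rewrite exchange_big.
rewrite exchange_big; apply: eq_bigr => e _.
under eq_bigr do rewrite exchange_big.
rewrite exchange_big; apply: eq_bigr => k _; rewrite -hGiE mulr_suml.
by apply: eq_bigr => a _; rewrite mulr_suml.
Qed.

Lemma plapD Gi dG p p' q q' :
  plap Gi dG (fun a => p a + p' a) (fun a b => q a b + q' a b) =
  plap Gi dG p q + plap Gi dG p' q'.
Proof.
rewrite -big_split; apply: eq_bigr => a _; rewrite -big_split; apply: eq_bigr => b _ /=.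
rewrite (eq_bigr _ (fun c _ => mulrDr _ _ _)) big_split /=; ring.
Qed.

Lemma plapZ Gi dG p q k :
  plap Gi dG (fun a => k * p a) (fun a b => k * q a b) = k * plap Gi dG p q.
Proof.
rewrite mulr_sumr; apply: eq_bigr => a _; rewrite mulr_sumr; apply: eq_bigr => b _.
by rewrite (eq_bigr _ (fun c _ => mulrCA _ _ _)) -mulr_sumr; ring.
Qed.

Lemma plap0 Gi dG p L : plap Gi dG (fun=> 0) (fun a b => p a * L b) = pdot Gi p L.
Proof.
apply: eq_bigr => a _; apply: eq_bigr => b _.
by rewrite big1 ?subr0 // => c _; rewrite mulr0.
Qed.

Lemma pdotD Gi p L L' : pdot Gi p (fun a => L a + L' a) = pdot Gi p L + pdot Gi p L'.
Proof.
rewrite -big_split; apply: eq_bigr => a _; rewrite -big_split; apply: eq_bigr => b _ /=; ring.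
Qed.

Lemma pdotZ Gi p L k : pdot Gi p (fun a => k * L a) = k * pdot Gi p L.
Proof.
rewrite mulr_sumr; apply: eq_bigr => a _; rewrite mulr_sumr; apply: eq_bigr => b _ /=; ring.
Qed.

Lemma pdot_delta Gi (o : 'I_m) p : (forall b, Gi o b = (o == b)%:R) ->
  pdot Gi (fun a => (a == o)%:R) p = p o.
Proof.
move=> GiE; rewrite /pdot (bigD1 o) //= (bigD1 o) //= GiE !eqxx !mul1r.
rewrite big1 ?addr0 => [|b bo]; last by rewrite GiE eq_sym (negPf bo) mul0r.
rewrite big1 ?addr0 // => a /negPf ao; rewrite big1 // => b _.
by rewrite ao mul0r mulr0.
Qed.

Lemma congr_inv (H Hi J hG hGi : 'M[K]_m) : H *m Hi = 1%:M -> hG *m hGi = 1%:M ->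
  J *m hG *m J^T = H -> J^T *m Hi *m J = hGi.
Proof.
move=> HHi GGi HE; have : J *m (hG *m J^T *m Hi) = 1%:M by rewrite !mulmxA HE.
move=> /mulmx1C; rewrite -!mulmxA => e.
by rewrite -[LHS]mul1mx -(mulmx1C GGi) -[hGi in RHS]mulmx1 -e !mulmxA.
Qed.

(** * The conjugation identity on jets at a point with $r \neq 0$ *)

Section ShiftIdentity.
(* [C a b k] is the second derivative of the component [k] of a map with
   Jacobian [J], which sends the metric [G] to [hG] up to the factor [rho ^+ 2];
   [o] is the index of the coordinate [r], and [f] is the pull-back of [r]. *)
Variables (n : nat) (o : 'I_m) (G Gi hG hGi J : 'M[K]_m) (dG dhG : 'I_m -> 'M[K]_m).
Variables (C : 'I_m -> 'I_m -> 'I_m -> K) (r f : K).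
Let pr (a : 'I_m) : K := (a == o)%:R.
Let pf (a : 'I_m) : K := J a o.
Let rho := f / r.
Let L a := pf a / f - pr a / r.
Let LL a b := C a b o / f - pf a * pf b / f ^+ 2 + pr a * pr b / r ^+ 2.
Hypotheses (nz2 : (2 : K) != 0) (nzr : r != 0) (nzf : f != 0) (mE : m = n.+1).
Hypotheses (GGi : G *m Gi = 1%:M) (GT : G^T = G) (GiT : Gi^T = Gi).
Hypotheses (hGGi : hG *m hGi = 1%:M) (hGT : hG^T = hG).
Hypotheses (Gio : forall b, Gi o b = (o == b)%:R) (hGio : forall b, hGi o b = (o == b)%:R).
Hypotheses (CS : forall a b k, C a b k = C b a k) (JhG : J *m hG *m J^T = rho ^+ 2 *: G).
Hypothesis (dJhG : forall a b d,
  rho ^+ 2 * (dG a b d + 2 * L a * G b d) = \sum_k \sum_l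
     (C a b k * hG k l * J d l + J b k * (\sum_e J a e * dhG e k l) * J d l
      + J b k * hG k l * C a d l)).

(** [E] stands for $\rho^s$ and [L], [LL] for the first and second derivatives of $\log\rho$. The
    pairs [pu], [qu]; [pU], [qU]; [pv], [qv] are the jets of $u$, of $u\circ F$ and of $v =
    \rho^s\,(u\circ F)$. *)
Lemma shift_identity (s E U : K) (pu pU pv : 'I_m -> K) (qu qU qv : 'I_m -> 'I_m -> K) :
  (forall a, pU a = \sum_k J a k * pu k) ->
  (forall a b, qU a b = \sum_k (C a b k * pu k + J b k * \sum_l J a l * qu l k)) ->
  (forall a, pv a = E * (s * L a * U + pU a)) ->
  (forall a b, qv a b = E * (s * L a * (s * L b * U + pU b) + s * LL a b * U
                             + s * L b * pU a + qU a b)) ->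
  r * plap Gi dG pv qv + (2 * s - n%:R + 1) * pv o
    + s * plap Gi dG pr (fun _ _ => 0) * (E * U) =
  rho * E * (f * plap hGi dhG pu qu + (2 * s - n%:R + 1) * pu o
    + s * plap hGi dhG pr (fun _ _ => 0) * U).
Proof.
move=> pUE qUE pvE qvE.
have nzrho : rho != 0 by rewrite mulf_neq0 ?invr_eq0.
have nzk : rho ^+ 2 != 0 by rewrite expf_neq0.
have GiG := mulmx1C GGi.
(* The metric $\rho^2G$, with inverse [Hi] and derivatives [dH], is both conformal to [G] and the
   pull-back of [hG]. The two transformation laws are composed through it. *)
pose Hi := (rho ^+ 2)^-1 *: Gi.
pose dH a := rho ^+ 2 *: (dG a + (2 * L a) *: G).
have JHJ : J^T *m Hi *m J = hGi.
  apply: (congr_inv (H := rho ^+ 2 *: G)) hGGi JhG.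
  by rewrite /Hi -scalemxAl -scalemxAr scalerA mulfV // scale1r.
have pull hp hq p q : (forall a, p a = \sum_k J a k * hp k) ->
  (forall a b, q a b = \sum_k (C a b k * hp k + J b k * \sum_l J a l * hq l k)) ->
  plap hGi dhG hp hq = (rho ^+ 2)^-1 * (plap Gi dG p q + (m%:R - 2) * pdot Gi L p).
  move=> pE qE; rewrite -(plap_conformal (G := G) (dH := dH)) //.
  symmetry; apply: (plap_pullback (hG := hG) (J := J) (C := C)) => // a b d.
  by rewrite -dJhG /dH !mxE.
have pullpr p : pdot hGi pr p = p o by apply: pdot_delta.
have dotr p : pdot Gi pr p = p o by apply: pdot_delta.
have pro : pr o = 1 by rewrite /pr eqxx.
have pfE a : pf a = \sum_k J a k * pr k.
  by rewrite (bigD1 o) //= /pr eqxx mulr1 big1 ?addr0 // => k /negPf->; rewrite mulr0.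
have dotHi (p q : 'I_m -> K) : pdot Hi p q = (rho ^+ 2)^-1 * pdot Gi p q.
  rewrite mulr_sumr; apply: eq_bigr => a _; rewrite mulr_sumr.
  by apply: eq_bigr => b _; rewrite mxE -mulrA.
have ffE : pdot Gi pf pf = rho ^+ 2.
  have := pdot_pullback JHJ pfE pfE; rewrite pullpr dotHi /pr eqxx.
  by move=> /(congr1 (fun x => rho ^+ 2 * x)); rewrite mulrA mulfV // mul1r mulr1.
have fUE : pdot Gi pf pU = rho ^+ 2 * pu o.
  have := pdot_pullback JHJ pfE pUE; rewrite pullpr dotHi => <-.
  by rewrite mulrA mulfV // mul1r.
(* The law is also applied to the coordinate $r$ itself, whose pull-back [f] has second derivatives
   [C a b o]. The Laplacian of [f] that appears cancels the one contained in the trace of [LL]. *)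
rewrite (pull _ _ _ _ pUE qUE) (pull pr (fun _ _ => 0) pf (fun a b => C a b o)) //; last first.
  move=> a b; under eq_bigr => k _.
    rewrite big1 => [|l _]; last by rewrite mulr0.
    rewrite mulr0 addr0; over.
  rewrite (bigD1 o) //= /pr eqxx mulr1 big1 ?addr0 // => k /negPf->.
  by rewrite mulr0.
have LE p : pdot Gi L p = pdot Gi pf p / f - p o / r.
  rewrite -(dotr p) ![pdot Gi _ p]pdotC // [pdot Gi p pf / f]mulrC.
  rewrite [_ / r]mulrC -mulNr -!pdotZ -pdotD; apply: pdot_ext => // a.
  by rewrite /L; ring.
have LLE : plap Gi dG L LL = f^-1 * plap Gi dG pf (fun a b => C a b o)
    + (- f ^- 2) * pdot Gi pf pf + (- r^-1) * plap Gi dG pr (fun _ _ => 0)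
    + r ^- 2 * pdot Gi pr pr.
  rewrite -!(plap0 Gi dG) -!plapZ -!plapD.
  by apply: plap_ext => [a|a b]; rewrite /L /LL; ring.
have vE : plap Gi dG pv qv = E * (s ^+ 2 * U * pdot Gi L L + 2 * s * pdot Gi L pU
    + s * U * plap Gi dG L LL + plap Gi dG pU qU).
  have -> : 2 * s * pdot Gi L pU = s * pdot Gi L pU + s * pdot Gi pU L.
    by rewrite [pdot Gi pU L]pdotC //; ring.
  rewrite -!(plap0 Gi dG) -!plapZ -!plapD -plapZ.
  by apply: plap_ext => [a|a b]; rewrite ?pvE ?qvE; ring.
(* By [ffE] this equals $-(2/r)$ times [L o], which is what makes the coefficient of $s^2U$
   vanish. *)
have LLo : pdot Gi L L = 1 / r ^+ 2 - 2 * pf o / (f * r) + 1 / r ^+ 2.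
  rewrite LE pdotC // LE ffE /L /rho pro; field; by rewrite nzr nzf.
have -> : m%:R = n%:R + 1 :> K by rewrite mE natr1.
rewrite vE LLE LLo !LE fUE ffE dotr pvE /L /rho pro; field; by rewrite nzr nzf.
Qed.

End ShiftIdentity.
End Algebra.

(** The metric jets are real while $u$ and $s$ are complex. This carries the real geometry into
    [R[i]], where [shift_identity] is applied. *)
Lemma plap_map (K K' : fieldType) (phi : {rmorphism K -> K'}) m (Gi : 'M[K]_m)
    (dG : 'I_m -> 'M[K]_m) p q :
  phi (plap Gi dG p q) =
  plap (map_mx phi Gi) (fun a => map_mx phi (dG a)) (fun a => phi (p a)) (fun a b => phi (q a b)).
Proof.
rewrite rmorph_sum; apply: eq_bigr => a _; rewrite rmorph_sum; apply: eq_bigr => b _.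
rewrite rmorphM rmorphB rmorph_sum mxE; congr (_ * (_ - _)); apply: eq_bigr => c _.
rewrite rmorphM; congr (_ * _).
rewrite /chr rmorphM fmorphV rmorph_nat rmorph_sum; congr (_ * _).
by apply: eq_bigr => d _; rewrite rmorphM !rmorphB rmorphD /low_chr !mxE.
Qed.

(** * Metrics of the form $dr^2 + h$ and the Laplacian of $r$ *)

Section Radial.
Variables (K : fieldType) (n : nat) (h : 'M[K]_n).
Let o : 'I_(1 + n) := lshift n ord0.
Let G : 'M[K]_(1 + n) := block_mx 1%:M 0 0 h.
Hypotheses (hU : h \in unitmx) (hT : h^T = h).

Lemma radial_mulV : G *m block_mx 1%:M 0 0 (invmx h) = 1%:M.
Proof.
rewrite mulmx_block !mul0mx !mulmx0 !mul1mx !addr0 !add0r mulmxV //.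
by rewrite -scalar_mx_block.
Qed.

Lemma radial_unit : G \in unitmx.
Proof. by have [] := mulmx1_unit radial_mulV. Qed.

Lemma invmx_radial : invmx G = block_mx 1%:M 0 0 (invmx h).
Proof. by rewrite -[LHS]mulmx1 -radial_mulV mulKmx // radial_unit. Qed.

Lemma radial_sym : G^T = G.
Proof. by rewrite tr_block_mx trmx1 !trmx0 hT. Qed.

Lemma invmx_radial_sym : (invmx G)^T = invmx G.
Proof. by rewrite trmx_inv radial_sym. Qed.

Lemma radial_row (A : 'M[K]_n) b : block_mx 1%:M 0 0 A o b = (o == b)%:R :> K.
Proof.
case: (split_ordP b) => k ->; rewrite ?block_mxEul ?block_mxEur mxE.
  by rewrite !ord1 !eqxx.
by rewrite eq_lrshift.
Qed.

(** The second derivatives of $r$ vanish, so its Laplacian is $-G^{ab}\Gamma^r_{ab}$. Entries with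
    an index [o] are constant, hence $\Gamma^r_{ab} = -\frac12\partial_rG_{ab}$ and only the
    tangential block contributes. *)
Lemma plap_radial (dG : 'I_(1 + n) -> 'M[K]_(1 + n)) :
  (forall a b, dG a b o = 0) -> (forall a b, dG a o b = 0) ->
  plap (invmx G) dG (fun a => (a == o)%:R) (fun _ _ => 0) =
  2^-1 * \tr (invmx h *m drsubmx (dG o)).
Proof.
move=> dG1 dG2.
have GiE b : invmx G o b = (o == b)%:R by rewrite invmx_radial radial_row.
have chrE a b : chr (invmx G) dG o a b = - (2^-1 * dG o a b).
  rewrite /chr (bigD1 o) //= GiE eqxx mul1r big1 ?addr0 => [|d /negPf od].
    by rewrite /low_chr !dG1 !add0r mulrN.
  by rewrite GiE eq_sym od mul0r.
transitivity (\sum_a \sum_b invmx G a b * (2^-1 * dG o a b)).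
  apply: eq_bigr => a _; apply: eq_bigr => b _; rewrite sub0r (bigD1 o) //= ?eqxx.
  rewrite mulr1 chrE big1 ?addr0 ?opprK // => c /negPf->; exact: mulr0.
rewrite big_split_ord /= big_ord1 big1 ?add0r => [|b _]; last first.
  by rewrite (_ : lshift n ord0 = o) // dG2 !mulr0.
rewrite exchange_big big_split_ord /= big_ord1 big1 ?add0r => [|b _]; last first.
  by rewrite (_ : lshift n ord0 = o) // dG1 !mulr0.
rewrite mulr_sumr; apply: eq_bigr => b _; rewrite mxE mulr_sumr; apply: eq_bigr => a _.
rewrite invmx_radial block_mxEdr !mxE.
have -> : invmx h a b = invmx h b a by rewrite -{1}hT -trmx_inv mxE.
by rewrite mulrCA.
Qed.

End Radial.

(** * One-sided partial derivatives *)

Lemma cvg_sumr (R : realType) (T : Type) (S : set_system T) {FS : Filter S}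
    (I : Type) (r : seq I) (q : I -> T -> R) (l : I -> R) :
  (forall i, q i t @[t --> S] --> l i) ->
  (\sum_(i <- r) q i t) @[t --> S] --> \sum_(i <- r) l i.
Proof.
move=> ql; elim: r => [|i r IH].
  by rewrite big_nil; under eq_fun do rewrite big_nil; exact: cvg_cst.
by rewrite big_cons; under eq_fun do rewrite big_cons; exact: cvgD.
Qed.

Section PartialDerivatives.
Variables (R : realType) (m : nat).
Implicit Types (D : set 'rV[R]_m) (f g : 'rV[R]_m -> R) (x y z : 'rV[R]_m) (a b : 'I_m).

Definition axis a x (t : R) : 'rV[R]_m := x + t *: delta_mx 0 a.

(** [pd] has a value even where the quotients diverge, so the rules of calculus are stated with the
    convergence itself. Uniqueness of the limit enters only when passing back to [pd], for which the
    filter has to be proper. *)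
Definition has_pd D a f x (l : R) := diffquot f a x t @[t --> steps D a x] --> l.

Global Instance steps_filter D a x : Filter (steps D a x).
Proof. exact: within_filter. Qed.

Lemma axis0 a x : axis a x 0 = x. Proof. by rewrite /axis scale0r addr0. Qed.

Lemma axisE a x t b : axis a x t 0 b = x 0 b + (b == a)%:R * t.
Proof. by rewrite !mxE eqxx /= mulrC. Qed.

Lemma axisD a x s t : axis a (axis a x s) t = axis a x (s + t).
Proof. by rewrite /axis scalerDl addrA. Qed.

Lemma axis_continuous a x : continuous (axis a x).
Proof.
move=> t; apply: cvgD; first exact: cvg_cst.
by apply: cvgZ; [exact: cvg_id | exact: cvg_cst].
Qed.

Lemma steps_neq0 D a x : \forall t \near steps D a x, t != 0.
Proof.
rewrite near_withinE; apply: filterS (nbhs_dnbhs_neq (0 : R)) => t t0 _.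
exact: t0.
Qed.

Lemma steps_in D a x : \forall t \near steps D a x, D (axis a x t).
Proof. exact: withinT. Qed.

Lemma steps_cvg0 D a x : t @[t --> steps D a x] --> (0 : R).
Proof.
apply: (@cvg_trans _ (0 : R)^'); first exact: cvg_within.
exact: cvg_within.
Qed.

Lemma steps_cvg D a x : axis a x t @[t --> steps D a x] --> x.
Proof.
apply: (@cvg_trans _ (axis a x t @[t --> (0 : R)])).
  exact: (@cvg_app _ _ _ _ (axis a x) (@steps_cvg0 D a x)).
by have := @axis_continuous a x 0; rewrite /continuous_at axis0.
Qed.

Lemma axis_cvg a x : axis a x t @[t --> (0 : R)^'] --> x.
Proof.
apply: (@cvg_trans _ (axis a x t @[t --> (0 : R)])).
  have le0 : (0 : R)^' --> (0 : R) by exact: cvg_within.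
  exact: (@cvg_app _ _ _ _ (axis a x) le0).
by have := @axis_continuous a x 0; rewrite /continuous_at axis0.
Qed.

Lemma near_steps D a x (P : set 'rV[R]_m) :
  (\forall y \near x, D y -> P y) -> \forall t \near steps D a x, P (axis a x t).
Proof.
move=> /(@steps_cvg D a) nP; near=> t; have : D (axis a x t) by near: t; exact: steps_in.
by near: t; exact: nP.
Unshelve. all: by end_near. Qed.

Lemma has_pd_near D a f g x l : D x -> (\forall y \near x, D y -> f y = g y) ->
  has_pd D a f x l -> has_pd D a g x l.
Proof.
move=> Dx fg; apply: cvg_trans; apply: near_eq_cvg.
have fgx : f x = g x by apply: (nbhs_singleton fg).
have /near_steps fgt : \forall y \near x, D y -> f y = g y by exact: fg.
by apply: filterS (fgt a) => t; rewrite /diffquot -/(axis a x t) fgx => ->.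
Qed.

Lemma steps_eq D E a x : (\forall y \near x, D y <-> E y) -> steps D a x = steps E a x.
Proof.
move=> DE.
have DEt : \forall t \near (0 : R)^', D (axis a x t) <-> E (axis a x t).
  exact: (@axis_cvg a x _ DE).
apply/predeqP => P; split => nP; rewrite /steps /within /= in nP *.
  by near=> t => Et; apply: (near nP t) => //; exact/(near DEt t).
by near=> t => Dt; apply: (near nP t) => //; exact/(near DEt t).
Unshelve. all: by end_near. Qed.

Lemma has_pd_steps D E a f x l : (\forall y \near x, D y <-> E y) ->
  has_pd D a f x l -> has_pd E a f x l.
Proof. by move=> DE; rewrite /has_pd (steps_eq a DE). Qed.

Lemma pd_steps D E a f x : (\forall y \near x, D y <-> E y) -> pd D a f x = pd E a f x.
Proof. by move=> DE; rewrite /pd (steps_eq a DE). Qed.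

Lemma steps_lim D a x (l : R) (q q' : R -> R) : q t @[t --> steps D a x] --> l ->
  (forall t, t != 0 -> D (axis a x t) -> q t = q' t) -> q' t @[t --> steps D a x] --> l.
Proof.
move=> ql qE; apply: cvg_trans ql; apply: near_eq_cvg; near=> t; apply: qE.
  by near: t; exact: steps_neq0.
by near: t; exact: steps_in.
Unshelve. all: by end_near. Qed.

Lemma has_pd_lim D a f x l (q : R -> R) : q t @[t --> steps D a x] --> l ->
  (forall t, t != 0 -> D (axis a x t) -> q t = diffquot f a x t) -> has_pd D a f x l.
Proof. exact: steps_lim. Qed.

Lemma has_pd_eq D a f x l l' : has_pd D a f x l' -> l' = l -> has_pd D a f x l.
Proof. by move=> fl <-. Qed.

Lemma has_pd_cst D a (c : R) x : has_pd D a (cst c) x 0.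
Proof.
rewrite /has_pd /diffquot; under eq_fun do rewrite subrr mul0r.
exact: cvg_cst.
Qed.

Lemma has_pd_coord D a b x : has_pd D a (fun y => y 0 b) x (b == a)%:R.
Proof.
apply: cvg_near_cst; near=> t; have t0 : t != 0 by near: t; exact: steps_neq0.
by rewrite /diffquot -/(axis a x t) axisE addrAC subrr add0r mulfK.
Unshelve. all: by end_near. Qed.

Lemma has_pdD D a f g x l k : has_pd D a f x l -> has_pd D a g x k ->
  has_pd D a (fun y => f y + g y) x (l + k).
Proof.
move=> fl gk; apply: has_pd_lim (cvgD fl gk) _ => t _ _.
by rewrite /diffquot -mulrDl addrACA opprD.
Qed.

Lemma has_pdN D a f x l : has_pd D a f x l -> has_pd D a (fun y => - f y) x (- l).
Proof.
move=> fl; apply: has_pd_lim (cvgN fl) _ => t _ _.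
by rewrite /diffquot -mulNr opprB opprK addrC.
Qed.

Lemma has_pd_continuous D a f x l : has_pd D a f x l ->
  f (axis a x t) @[t --> steps D a x] --> f x.
Proof.
move=> fl.
have tfl : (t * diffquot f a x t + f x) @[t --> steps D a x] --> 0 * l + f x.
  by apply: cvgD; [exact: cvgM (@steps_cvg0 D a x) fl | exact: cvg_cst].
rewrite mul0r add0r in tfl; apply: steps_lim tfl _ => t t0 _.
by rewrite /= /diffquot mulrC divfK // subrK.
Qed.

Lemma has_pdM D a f g x l k : has_pd D a f x l -> has_pd D a g x k ->
  has_pd D a (fun y => f y * g y) x (l * g x + f x * k).
Proof.
move=> fl gk.
have fgl : (diffquot f a x t * g (axis a x t) + f x * diffquot g a x t)
    @[t --> steps D a x] --> l * g x + f x * k.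
  apply: cvgD; first exact: cvgM fl (has_pd_continuous gk).
  by apply: cvgM gk; exact: cvg_cst.
by apply: has_pd_lim fgl _ => t _ _; rewrite /diffquot /axis; ring.
Qed.

Lemma has_pd_sum D a (I : Type) (r : seq I) (F : I -> 'rV[R]_m -> R) (l : I -> R) x :
  (forall i, has_pd D a (F i) x (l i)) ->
  has_pd D a (fun y => \sum_(i <- r) F i y) x (\sum_(i <- r) l i).
Proof.
move=> Fl; elim: r => [|i r IH].
  rewrite big_nil; under eq_fun do rewrite big_nil; exact: has_pd_cst.
by rewrite big_cons; under eq_fun do rewrite big_cons; exact: has_pdD.
Qed.

Lemma has_pd_comp1 D a f x l (phi : R -> R) d : is_derive (f x) 1 phi d ->
  has_pd D a f x l -> has_pd D a (phi \o f) x (d * l).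
Proof.
move=> [dphi <-] fl.
(* The slope of [phi] from [f x], extended by the derivative: it is continuous at [f x] and avoids
   dividing by an increment of [f] that may vanish. *)
pose psi s := if s == f x then 'D_1 phi (f x) else (phi s - phi (f x)) / (s - f x).
have psiE s : phi s - phi (f x) = psi s * (s - f x).
  rewrite /psi; case: eqP => [->|/eqP sx]; first by rewrite !subrr mulr0.
  by rewrite divfK // subr_eq0.
have cpsi : psi s @[s --> f x] --> psi (f x).
  rewrite {2}/psi eqxx.
  apply/cvgrPdist_lt => e e0.
  have /cvgrPdist_lt /(_ e e0) H := dphi.
  have sub0 : (s - f x) @[s --> f x] --> (0 : R).
    have : (s - f x) @[s --> f x] --> f x - f x.
      by apply: cvgB; [exact: cvg_id|exact: cvg_cst].
    by rewrite subrr.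
  have : \forall h \near (0 : R), h != 0 -> `|'D_1 phi (f x) - h^-1 *:
      ((phi \o shift (f x)) (h *: 1) - phi (f x))| < e.
    by move: H; rewrite near_withinE.
  move=> /sub0 H3.
  have {}H3 : \forall s \near f x, s - f x != 0 -> `|'D_1 phi (f x) - (s - f x)^-1 *:
      ((phi \o shift (f x)) ((s - f x) *: 1) - phi (f x))| < e by exact: H3.
  near=> s; rewrite /psi; case: ifPn => [_|sx]; first by rewrite subrr normr0.
  have : s - f x != 0 by rewrite subr_eq0.
  move=> sx0; have := near H3 s _ sx0; rewrite /= [(s - f x) *: _]mulr1 subrK [X in `|_ - X|]mulrC.
  by apply.
have pfl : (psi (f (axis a x t)) * diffquot f a x t) @[t --> steps D a x] --> psi (f x) * l.
  by apply: cvgM (fl); exact: (cvg_comp _ _ (has_pd_continuous fl) cpsi).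
rewrite {2}/psi eqxx in pfl; apply: has_pd_lim pfl _ => t _ _.
by rewrite /diffquot psiE mulrA.
Unshelve. all: by end_near. Qed.

Lemma has_pd_pd D a f x l : ProperFilter (steps D a x) -> has_pd D a f x l -> pd D a f x = l.
Proof. by move=> P fl; apply/cvg_lim. Qed.

Lemma cvg_has_pd D a f x : cvg (diffquot f a x @ steps D a x) -> has_pd D a f x (pd D a f x).
Proof. by []. Qed.

Lemma Ck_has_pd k D a f x : Ck k.+1 D f -> D x -> has_pd D a f x (pd D a f x).
Proof. by move=> [_ /(_ a)[cf _]] Dx; apply: cvg_has_pd; exact: cf. Qed.

Lemma Ck_pd k D a f : Ck k.+1 D f -> Ck k D (pd D a f).
Proof. by move=> [_ /(_ a)[]]. Qed.

Lemma Ck_continuous k D f : Ck k D f -> {within D, continuous f}.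
Proof. by case: k => [|k] []. Qed.

Lemma Ck_S k D f : Ck k.+1 D f -> Ck k D f.
Proof.
elim: k f => [f [cf _]|k IH f [cf df]]; first by split.
by split=> // a; have [df1 df2] := df a; split=> //; exact: IH.
Qed.


Lemma Ck_cvg k D f x : Ck k D f -> D x -> f y @[y --> within D (nbhs x)] --> f x.
Proof. by move=> /Ck_continuous/subspace_continuousP; exact. Qed.

End PartialDerivatives.

(** * Half-space calculus: mean values, first-order expansion, chain rule, symmetry of second
    derivatives *)

Section HalfSpace.
Variables (R : realType) (m : nat) (o : 'I_m).
Implicit Types (D : set 'rV[R]_m) (f g : 'rV[R]_m -> R) (x y z w : 'rV[R]_m) (a b : 'I_m).

(** relatively open subsets of the half-space [{y_o >= 0}] *)
Definition hopen D := forall y, D y ->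
  0 <= y 0 o /\ nbhs y (fun z : 'rV[R]_m => 0 <= z 0 o -> D z).

(** A positive step along any axis keeps $y_o \ge 0$, so right-hand steps are admissible even at
    boundary points. This makes one-sided derivatives unique. *)
Lemma hopen_steps D a x : hopen D -> D x -> (0 : R)^'+ --> steps D a x.
Proof.
move=> hD Dx P; rewrite /steps /within /= => nP.
have [x0 nD] := hD _ Dx.
have le0 : (0 : R)^'+ --> (0 : R)^'.
  by apply: within_subset => t t0; rewrite /= gt_eqF.
have DP : \forall t \near (0 : R)^'+, D (axis a x t) -> P t by exact: (le0 _ nP).
have DD : \forall t \near (0 : R)^'+, 0 <= (axis a x t) 0 o -> D (axis a x t).
  exact: le0 _ (@axis_cvg R m a x _ nD).
near=> t; apply: (near DP t) => //; apply: (near DD t) => //.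
by rewrite axisE addr_ge0 // mulr_ge0.
Unshelve. all: by end_near. Qed.

Lemma hopen_proper D a x : hopen D -> D x -> ProperFilter (steps D a x).
Proof.
move=> hD Dx; split; last exact: steps_filter.
move=> s0; have r0 : (0 : R)^'+ set0 by exact: (hopen_steps hD Dx) s0.
by have [] := filter_ex r0.
Qed.

(** If [D] contains a whole interval of the axis around the point, the admissible steps form the
    full punctured neighbourhood of 0, and [pd] is an ordinary derivative to which the mean value
    theorem applies. *)
Lemma axis_derive D a f z t (P := axis a z t) :
  (\forall s \near t, D (axis a z s)) -> cvg (diffquot f a P @ steps D a P) ->
  is_derive t 1 (fun s => f (axis a z s)) (pd D a f P).
Proof.
move=> nD cf.
have ht : (h + t) @[h --> (0 : R)] --> t.
  have : (h + t) @[h --> (0 : R)] --> 0 + t by apply: cvgD; [exact: cvg_id|exact: cvg_cst].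
  by rewrite add0r.
have nD0 : \forall h \near (0 : R), D (axis a P h).
  have H : \forall h \near (0 : R), D (axis a z (h + t)) by exact: ht _ nD.
  by near=> h; rewrite /P axisD addrC; near: h.
have sE : steps D a P = (0 : R)^'.
  apply/predeqP => A; split => nA; last exact: cvg_within nA.
  have nA' : \forall h \near (0 : R)^', D (axis a P h) -> A h by exact: nA.
  have nD' : \forall h \near (0 : R)^', D (axis a P h) by exact: cvg_within nD0.
  by near=> h; apply: (near nA' h) => //; exact: (near nD' h).
have dE : (fun h => h^-1 *: (((fun s => f (axis a z s)) \o shift t) (h *: 1) - f (axis a z t)))
    = diffquot f a P.
  apply/funext => h /=; rewrite /diffquot -/(axis a P h) /P axisD [h%:A]mulr1 (addrC h).
  by rewrite [_ *: _]mulrC.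
rewrite /pd sE in cf *.
by split; rewrite /derivable /derive ?dE.
Unshelve. all: by end_near. Qed.

Lemma axis_mvt_pos D a f z s : 0 < s -> Ck 1 D f ->
  (forall t, 0 <= t <= s -> D (axis a z t)) ->
  exists2 t, 0 <= t <= s & f (axis a z s) - f z = pd D a f (axis a z t) * s.
Proof.
move=> s0 cf Dz; have /subspace_continuousP cf0 := Ck_continuous cf.
have [||t] := @MVT R (fun t => f (axis a z t)) (fun t => pd D a f (axis a z t)) 0 s s0.
- move=> t; rewrite in_itv/= => /andP[t0 ts].
  apply: axis_derive; last by have [_ /(_ a)[+ _]] := cf; apply; apply: Dz; rewrite !ltW.
  near=> r; apply: Dz; apply/andP; split; apply: ltW; near: r.
    exact: lt_nbhsr.
  exact: lt_nbhsl.
- apply/subspace_continuousP => t; rewrite /= in_itv/= => tI.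
  have Dt := Dz _ tI => A /(cf0 _ Dt) nA.
  have H : \forall r \near t, D (axis a z r) -> A (f (axis a z r)).
    exact: (@axis_continuous R m a z t _ nA).
  suff : \forall r \near within `[0, s]%classic (nbhs t), A (f (axis a z r)) by [].
  rewrite near_withinE; near=> r => /=; rewrite in_itv/= => /Dz.
  by apply: (near H r).
- rewrite in_itv/= subr0 axis0 => /andP[t0 ts] ->; exists t => //.
  by rewrite !ltW.
Unshelve. all: by end_near. Qed.

Lemma axis_mvt D a f z s : Ck 1 D f ->
  (forall t, 0 <= t <= 1 -> D (axis a z (t * s))) ->
  exists2 t, 0 <= t <= 1 & f (axis a z s) - f z = pd D a f (axis a z (t * s)) * s.
Proof.
move=> cf Dz; have [s0|s0|->] := ltgtP s 0; last first.
- by exists 0; rewrite ?lexx ?ler01 // axis0 mulr0 subrr.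
- have frac t : 0 <= t <= s -> 0 <= t / s <= 1.
    move=> /andP[t0 ts]; rewrite ler_pdivrMr // mul1r ts andbT.
    by rewrite divr_ge0 // ltW.
  have [|t /frac ts ->] := axis_mvt_pos (z := z) (a := a) s0 cf.
    by move=> t /frac /Dz; rewrite divfK // gt_eqF.
  by exists (t / s) => //; rewrite divfK // gt_eqF.
- have Ns0 : 0 < - s by rewrite oppr_gt0.
  have frac t : 0 <= t <= - s -> 0 <= 1 + t / s <= 1.
    move=> /andP[t0 ts]; have : t / - s <= 1 by rewrite ler_pdivrMr // mul1r.
    have : 0 <= t / - s by rewrite divr_ge0 // ltW.
    by rewrite invrN mulrN; lra.
  have fracE t : (1 + t / s) * s = s + t by rewrite mulrDl mul1r divfK ?lt_eqF.
  have [|t /frac ts] := axis_mvt_pos (z := axis a z s) (a := a) Ns0 cf.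
    by move=> t /frac /Dz; rewrite axisD fracE.
  rewrite !axisD subrr axis0 mulrN => /eqP; rewrite -opprB eqr_opp => /eqP->.
  by exists (1 + t / s) => //; rewrite fracE.
Qed.

Lemma ball_rowP x (e : R) y : 0 < e -> ball x e y <-> forall k, `|x 0 k - y 0 k| < e.
Proof.
move=> e0; split=> [[_ H] k|H]; first exact: (H 0 k).
by split=> // i k; rewrite ord1; exact: H.
Qed.

(** The coordinates of [z] are replaced one at a time by those of [w], with a mean value along each
    axis. The path remains in [D] because its [o]-coordinate stays between two nonnegative numbers;
    continuity of the partial derivatives controls the error. *)
Lemma C1_expand D f z : hopen D -> Ck 1 D f -> D z -> forall e, 0 < e ->
  nbhs z (fun w => D w -> `|f w - f z - \sum_k pd D k f z * (w 0 k - z 0 k)|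
                <= e * \sum_k `|w 0 k - z 0 k|).
Proof.
move=> hD cf Dz e e0; have [z0 nD] := hD _ Dz.
have npd : nbhs z (fun w => D w -> forall k, `|pd D k f w - pd D k f z| < e).
  have npdk k : nbhs z (fun w => D w -> `|pd D k f w - pd D k f z| < e).
    have /cvgrPdist_lt /(_ e e0) := Ck_cvg (Ck_pd k cf) Dz.
    by rewrite near_withinE; apply: filterS => w H Dw; rewrite distrC; exact: H.
  have : nbhs z (fun w => forall k, D w -> `|pd D k f w - pd D k f z| < e).
    exact: filter_forall npdk.
  by apply: filterS => w H Dw k; exact: H.
have /nbhs_ballP[d /= d0 dB] : nbhs z (fun w => (0 <= w 0 o -> D w) /\
    (D w -> forall k, `|pd D k f w - pd D k f z| < e)) by exact: filterI.
apply/nbhs_ballP; exists d => //= w zw Dw.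
have {zw} /(ball_rowP _ _ d0) zw := zw; have [w0 _] := hD _ Dw.
(* The corners of the path: the first [j] coordinates come from [w], the others from [z]. *)
pose I j : 'rV[R]_m := \row_k if (k < j)%N then w 0 k else z 0 k.
have IS (j : 'I_m) t : axis j (I j) t = \row_k if (k < j)%N then w 0 k else
    if k == j then z 0 k + t else z 0 k.
  apply/rowP => k; rewrite axisE !mxE; case: ltnP => [kj|jk].
    by rewrite (_ : (k == j) = false) ?mul0r ?addr0 //; apply/eqP => kjE; rewrite kjE ltnn in kj.
  by case: eqP => _; rewrite ?mul1r ?mul0r ?addr0.
have good (j : 'I_m) t : 0 <= t <= 1 ->
    let y := axis j (I j) (t * (w 0 j - z 0 j)) in
    D y /\ (forall k, `|pd D k f y - pd D k f z| < e).
  move=> /andP[t0 t1] y; have yB : ball z d y.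
    apply/ball_rowP => // k; rewrite /y IS mxE; case: ifP => // _; case: eqP => [->|_].
      rewrite opprD addNKr normrN normrM ger0_norm //.
      by apply: le_lt_trans (zw j); rewrite distrC ler_piMl.
    by rewrite subrr normr0.
  have [H1 H2] := dB _ yB; have Dy : D y; last by split=> //; exact: H2.
  apply: H1; rewrite /y IS mxE; case: ifP => // _; case: eqP => [<-|_] //.
  by move: w0 z0 t0 t1; nra.
have claim j : (j <= m)%N -> `|f (I j) - f z - \sum_(k < m | (k < j)%N) pd D k f z * (w 0 k - z 0 k)|
     <= e * \sum_(k < m | (k < j)%N) `|w 0 k - z 0 k|.
  elim: j => [_|j IH jm].
    rewrite !big_pred0 // mulr0 subr0 (_ : I 0%N = z) ?subrr ?normr0 //.
    by apply/rowP => k; rewrite mxE.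
  pose J := Ordinal jm.
  have IJ : I j.+1 = axis J (I j) (w 0 J - z 0 J).
    rewrite (IS J); apply/rowP => k; rewrite !mxE ltnS leq_eqVlt.
    rewrite -(inj_eq val_inj) /=; case: ltngtP => // kj.
    by rewrite (_ : k = J) 1?addrC ?subrK //; apply: val_inj.
  have sumS (F : 'I_m -> R) : \sum_(k < m | (k < j.+1)%N) F k =
      \sum_(k < m | (k < j)%N) F k + F J.
    rewrite (bigD1 J) ?ltnS //= addrC; congr (_ + _); apply: eq_bigl => k.
    by rewrite ltnS leq_eqVlt -(inj_eq val_inj) /=; case: ltngtP.
  have [t t01] := axis_mvt (a := J) (z := I j) (s := w 0 J - z 0 J) cf (fun t t01 => (good J t t01).1).
  rewrite -IJ => fI; rewrite !sumS.
  have -> : f (I j.+1) = f (I j) + (f (I j.+1) - f (I j)) by rewrite addrC subrK.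
  rewrite fI; set p := pd D J f _; set q := pd D J f z.
  have pq : `|p - q| <= e by rewrite ltW //; exact: (good J t t01).2.
  rewrite [X in `|X|](_ : _ = (f (I j) - f z - \sum_(k < m | (k < j)%N) pd D k f z * (w 0 k - z 0 k))
     + (p - q) * (w 0 J - z 0 J)); last by ring.
  apply: le_trans (ler_normD _ _) _; rewrite [leRHS]mulrDr lerD ?IH 1?ltnW //.
  by rewrite normrM ler_wpM2r.
have := claim m (leqnn m).
rewrite (_ : I m = w); last by apply/rowP => k; rewrite mxE ltn_ord.
have sumT (F : 'I_m -> R) : \sum_(k < m | (k < m)%N) F k = \sum_k F k.
  by apply: eq_bigl => k; rewrite ltn_ord.
by rewrite !sumT.
Qed.

(** The remainder of [C1_expand] is small relative to the increment of [F], and this increment is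
    $O(t)$ because each component has a derivative. Only directional information on [F] is therefore
    needed. *)
Lemma has_pd_chain D p (E : set 'rV[R]_p) (F : 'rV[R]_p -> 'rV[R]_m) f (a : 'I_p)
    (x : 'rV[R]_p) (d : 'I_m -> R) :
  hopen D -> Ck 1 D f -> E x -> (forall v, E v -> D (F v)) ->
  (forall k, has_pd E a (fun v => F v 0 k) x (d k)) ->
  has_pd E a (f \o F) x (\sum_k pd D k f (F x) * d k).
Proof.
move=> hD cf Ex EF dF; set z := F x; pose S := steps E a x.
pose q k t := diffquot (fun v => F v 0 k) a x t.
pose c t := F (axis a x t).
have cz : c t @[t --> S] --> z.
  have ck k : c t 0 k @[t --> S] --> z 0 k by exact: has_pd_continuous (dF k).
  move=> A /nbhs_ballP[e /= e0 eA].
  have : \forall t \near S, forall k, `|z 0 k - c t 0 k| < e.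
    by apply: filter_forall => k; have /cvgrPdist_lt /(_ e e0) := ck k.
  by apply: filterS => t H; apply: eA; apply/ball_rowP.
have sumq : (\sum_k pd D k f z * q k t) @[t --> S] --> \sum_k pd D k f z * d k.
  by apply: cvg_sumr => k; apply: cvgM; [exact: cvg_cst | exact: dF].
suff : (diffquot (f \o F) a x t - \sum_k pd D k f z * q k t) @[t --> S] --> (0 : R).
  move=> H; have H2 : (diffquot (f \o F) a x t - \sum_k pd D k f z * q k t
      + \sum_k pd D k f z * q k t) @[t --> S] --> 0 + \sum_k pd D k f z * d k.
    exact: cvgD.
  by rewrite add0r in H2; apply: has_pd_lim H2 _ => t _ _; rewrite subrK.
(* [K] dominates the sum of the quotients of the components, each eventually at most [|d k| + 1].
   The final [+ 1] keeps [K] positive even when [m] is 0. *)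
apply/cvgrPdist_le => e e0; pose K := \sum_k (`|d k| + 1) + 1.
have K0 : 0 < K.
  by rewrite ltr_wpDl // sumr_ge0 // => k _; rewrite addr_ge0.
have qB : \forall t \near S, forall k, `|q k t| <= `|d k| + 1.
  apply: filter_forall => k; have /cvgrPdist_le /(_ 1 ltr01) := dF k.
  apply: filterS => t; rewrite -/(q k t) => H.
  by have := ler_normB (d k) (d k - q k t); rewrite subKr; lra.
have eK0 : 0 < e / K by rewrite divr_gt0.
have nE : \forall t \near S, D (c t) -> `|f (c t) - f z - \sum_k pd D k f z * (c t 0 k - z 0 k)|
    <= e / K * \sum_k `|c t 0 k - z 0 k|.
  exact: cz _ (C1_expand hD cf (EF _ Ex) eK0).
near=> t; have t0 : t != 0 by near: t; exact: steps_neq0.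
have Dt : D (c t) by apply: EF; near: t; exact: steps_in.
have cE k : c t 0 k - z 0 k = q k t * t by rewrite /q /diffquot divfK.
have nEt := near nE t _ Dt; rewrite sub0r normrN.
have -> : diffquot (f \o F) a x t - \sum_k pd D k f z * q k t =
    (f (c t) - f z - \sum_k pd D k f z * (c t 0 k - z 0 k)) / t.
  rewrite /diffquot [RHS]mulrBl mulr_suml; congr (_ - _); apply: eq_bigr => k _.
  by rewrite cE mulrA mulfK.
rewrite normrM normfV ler_pdivrMr ?normr_gt0 //; apply: le_trans (nEt _) _ => //.
rewrite (eq_bigr (fun k => `|q k t| * `|t|)) => [|k _]; last by rewrite cE normrM.
rewrite -mulr_suml mulrA ler_wpM2r // -[leRHS](divfK (lt0r_neq0 K0)) ler_wpM2l ?(ltW eK0) //.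
rewrite /K ler_wpDr //; apply: ler_sum => k _; exact: (near qB t).
Unshelve. all: by end_near. Qed.

Lemma axisC a b x s t : axis a (axis b x s) t = axis b (axis a x t) s.
Proof. by rewrite /axis addrAC. Qed.

(** The second difference [Q] over a small square is symmetric in the two directions, while two mean
    values show that $Q/h^2$ tends to either iterated derivative. The whole square must lie in [D],
    which is why the point is interior. *)
Lemma schwarz D f a b x : Ck 2 D f -> nbhs x D ->
  pd D a (pd D b f) x = pd D b (pd D a f) x.
Proof.
move=> cf nD; have Dx : D x by exact: nbhs_singleton nD.
pose Q a b h := f (axis b (axis a x h) h) - f (axis a x h) - (f (axis b x h) - f x).
have Qlim a' b' e : 0 < e ->
    \forall h \near (0 : R)^'+, `|Q a' b' h / h ^+ 2 - pd D b' (pd D a' f) x| <= e.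
  move=> e0; have cf1 := Ck_pd a' cf.
  have npd : nbhs x (fun w => D w -> `|pd D b' (pd D a' f) w - pd D b' (pd D a' f) x| <= e).
    have /cvgrPdist_le /(_ e e0) := Ck_cvg (Ck_pd b' cf1) Dx.
    by rewrite near_withinE; apply: filterS => w H Dw; rewrite distrC; exact: H.
  have /nbhs_ballP[d /= d0 dB] : nbhs x (fun w => D w /\
    (D w -> `|pd D b' (pd D a' f) w - pd D b' (pd D a' f) x| <= e)) by exact: filterI.
  have inB s t : `|s| < d / 2 -> `|t| < d / 2 -> ball x d (axis b' (axis a' x s) t).
    rewrite !ltr_norml => /andP[s0 sd] /andP[t0 td]; apply/ball_rowP => // k.
    rewrite !axisE ltr_norml.
    by case: eqP => _; case: eqP => _; rewrite ?mul1r ?mul0r; lra.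
  near=> h; have h0 : 0 < h by [].
  have hd : h < d / 2 by near: h; apply: nbhs_right_lt; rewrite divr_gt0.
  have hd' s : 0 <= s <= h -> `|s| < d / 2.
    by move=> /andP[s0 sh]; rewrite ger0_norm //; exact: le_lt_trans hd.
  have Dst s t : `|s| < d / 2 -> `|t| < d / 2 -> D (axis b' (axis a' x s) t).
    by move=> sd td; apply: (dB _ _).1; exact: inB.
  have nearD s : 0 <= s <= h -> \forall r \near s, `|r| < d / 2.
    move=> /hd'; rewrite ltr_norml => /andP[s1 s2]; near=> r.
    by rewrite ltr_norml; apply/andP; split; near: r; [exact: lt_nbhsr|exact: lt_nbhsl].
  (* The first mean value is taken for [g], in the direction [a']; the second, for [k] below, in the
     direction [b']. *)
  pose g s := f (axis a' (axis b' x h) s) - f (axis a' x s).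
  pose dg s := pd D a' f (axis a' (axis b' x h) s) - pd D a' f (axis a' x s).
  have d20 : `|0 : R| < d / 2 by rewrite normr0 divr_gt0.
  have hd0 : `|h| < d / 2 by apply: hd'; rewrite lexx ltW.
  have D1 s : `|s| < d / 2 -> D (axis a' (axis b' x h) s).
    by move=> sd; rewrite axisC; exact: Dst.
  have D0 s : `|s| < d / 2 -> D (axis a' x s).
    by move=> sd; rewrite -(axis0 b' (axis a' x s)); exact: Dst.
  have cfD y : D y -> cvg (diffquot f a' y @ steps D a' y).
    by have [_ /(_ a')[+ _]] := cf; apply.
  have cpD y : D y -> cvg (diffquot (pd D a' f) b' y @ steps D b' y).
    by have [_ /(_ b')[+ _]] := cf1; apply.
  have dgE s : 0 <= s <= h -> is_derive s 1 g (dg s).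
    move=> sh; apply: is_deriveB.
      apply: axis_derive; last by apply/cfD/D1/hd'.
      by apply: filterS (nearD _ sh) => r; exact: D1.
    apply: axis_derive; last by apply/cfD/D0/hd'.
    by apply: filterS (nearD _ sh) => r; exact: D0.
  have [s sh gE] : exists2 s, 0 <= s <= h & g h - g 0 = dg s * (h - 0).
    have [||s] := @MVT R g dg 0 h h0.
    - by move=> s; rewrite in_itv/= => /andP[s0 sh]; apply: dgE; rewrite !ltW.
    - apply: derivable_within_continuous => s; rewrite in_itv/= => sh.
      by have [] := dgE _ sh.
    - by rewrite in_itv/= => /andP[s0 sh]; exists s => //; rewrite !ltW.
  pose k t := pd D a' f (axis b' (axis a' x s) t).
  have dkE t : 0 <= t <= h -> is_derive t 1 k (pd D b' (pd D a' f) (axis b' (axis a' x s) t)).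
    move=> th; apply: axis_derive; last by apply/cpD/Dst; exact: hd'.
    by apply: filterS (nearD _ th) => r; apply: Dst; exact: hd'.
  have [t th kE] : exists2 t, 0 <= t <= h &
      k h - k 0 = pd D b' (pd D a' f) (axis b' (axis a' x s) t) * (h - 0).
    have [||t] := @MVT R k (fun t => pd D b' (pd D a' f) (axis b' (axis a' x s) t)) 0 h h0.
    - by move=> t; rewrite in_itv/= => /andP[t0 th]; apply: dkE; rewrite !ltW.
    - apply: derivable_within_continuous => t; rewrite in_itv/= => th.
      by have [] := dkE _ th.
    - by rewrite in_itv/= => /andP[t0 th]; exists t => //; rewrite !ltW.
  have -> : Q a' b' h = g h - g 0 by rewrite /Q /g !axis0 axisC; ring.
  rewrite (_ : dg s = k h - k 0) in gE; last by rewrite /dg /k axis0 axisC.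
  rewrite gE kE subr0 expr2 -[_ * h * h]mulrA mulfK ?mulf_neq0 ?gt_eqF //.
  by apply: (dB _ _).2; [apply: inB|apply: Dst]; exact: hd'.
have QC a' b' h : Q a' b' h = Q b' a' h by rewrite /Q axisC; ring.
apply/eqP; rewrite -subr_eq0 -normr_le0; apply/ler_addgt0Pr => e e0.
have e20 : 0 < e / 2 by rewrite divr_gt0.
have nH : \forall h \near (0 : R)^'+,
    `|Q b a h / h ^+ 2 - pd D a (pd D b f) x| <= e / 2 /\
    `|Q a b h / h ^+ 2 - pd D b (pd D a f) x| <= e / 2.
  by apply: filterI; exact: Qlim.
have [h] := @filter_ex _ (0 : R)^'+ _ _ nH.
move=> [H1 H2].
rewrite add0r.
rewrite (QC b a h) in H1.
rewrite [leRHS]splitr.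
apply: le_trans (ler_distD (Q a b h / h ^+ 2) _ _) _.
by apply: lerD; [rewrite distrC; exact: H1|exact: H2].
Unshelve. all: by end_near. Qed.

End HalfSpace.

(** * Complex-valued functions *)

Lemma near_cvg (R : realType) (T : Type) (S : set_system T) {FS : Filter S} (q q' : T -> R)
    (l : R) :
  (\forall t \near S, q t = q' t) -> q t @[t --> S] --> l -> q' t @[t --> S] --> l.
Proof. by move=> qq; apply: cvg_trans; apply: near_eq_cvg; apply: filterS qq => t ->. Qed.

Lemma is_derive_invr (R : realType) (x : R) :
  x != 0 -> is_derive x 1 (fun t : R => t^-1) (- x ^- 2).
Proof.
by move=> x0; split; [exact: derivableV|rewrite deriveV // derive_id [_%:A]mulr1].
Qed.

Section ComplexDerivatives.
Variables (R : realType) (m : nat).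
Implicit Types (D : set 'rV[R]_m) (v w : 'rV[R]_m -> R[i]) (x : 'rV[R]_m) (a : 'I_m).

Definition cpd D a v x : R[i] :=
  pd D a (fun y => complex.Re (v y)) x +i* pd D a (fun y => complex.Im (v y)) x.

Definition chas_pd D a v x (l : R[i]) :=
  has_pd D a (fun y => complex.Re (v y)) x (complex.Re l) /\
  has_pd D a (fun y => complex.Im (v y)) x (complex.Im l).

Lemma chas_pd_cpd D a v x l : ProperFilter (steps D a x) -> chas_pd D a v x l ->
  cpd D a v x = l.
Proof.
by move=> P [vr vi]; rewrite /cpd (has_pd_pd P vr) (has_pd_pd P vi); case: l {vr vi}.
Qed.

Lemma chas_pd_near D a v w x l : D x -> (\forall y \near x, D y -> v y = w y) ->
  chas_pd D a v x l -> chas_pd D a w x l.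
Proof.
move=> Dx vw [vr vi]; split; [apply: has_pd_near vr|apply: has_pd_near vi] => //.
  by apply: filterS vw => y H Dy; rewrite H.
by apply: filterS vw => y H Dy; rewrite H.
Qed.

Lemma chas_pd_real D a (f : 'rV[R]_m -> R) x l :
  has_pd D a f x l -> chas_pd D a (fun y => (f y)%:C) x l%:C.
Proof. by split=> //=; exact: has_pd_cst. Qed.

Lemma chas_pd_cst D a (c : R[i]) x : chas_pd D a (fun=> c) x 0.
Proof. by split; exact: has_pd_cst. Qed.

Lemma cReD (c d : R[i]) : complex.Re (c + d) = complex.Re c + complex.Re d.
Proof. by case: c d => ? ? []. Qed.

Lemma cImD (c d : R[i]) : complex.Im (c + d) = complex.Im c + complex.Im d.
Proof. by case: c d => ? ? []. Qed.

Lemma cReM (c d : R[i]) : complex.Re (c * d) =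
  complex.Re c * complex.Re d - complex.Im c * complex.Im d.
Proof. by case: c d => ? ? []. Qed.

Lemma cImM (c d : R[i]) : complex.Im (c * d) =
  complex.Re c * complex.Im d + complex.Im c * complex.Re d.
Proof. by case: c d => ? ? []. Qed.

Lemma complex_ext (c d : R[i]) : complex.Re c = complex.Re d ->
  complex.Im c = complex.Im d -> c = d.
Proof. by case: c d => ? ? [] ? ? /= -> ->. Qed.

Lemma chas_pdD D a v w x l k : chas_pd D a v x l -> chas_pd D a w x k ->
  chas_pd D a (fun y => v y + w y) x (l + k).
Proof.
move=> [vr vi] [wr wi]; split; rewrite (cReD, cImD).
  by under eq_fun do rewrite cReD; exact: has_pdD.
by under eq_fun do rewrite cImD; exact: has_pdD.
Qed.

Lemma chas_pdM D a v w x l k : chas_pd D a v x l -> chas_pd D a w x k ->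
  chas_pd D a (fun y => v y * w y) x (l * w x + v x * k).
Proof.
move=> [vr vi] [wr wi]; split.
  under eq_fun do rewrite cReM.
  apply: has_pd_eq (has_pdD (has_pdM vr wr) (has_pdN (has_pdM vi wi))) _.
  by rewrite cReD !cReM; ring.
under eq_fun do rewrite cImM.
apply: has_pd_eq (has_pdD (has_pdM vr wi) (has_pdM vi wr)) _.
by rewrite cImD !cImM; ring.
Qed.

Lemma chas_pd_sum D a (I : Type) (r : seq I) (F : I -> 'rV[R]_m -> R[i]) (l : I -> R[i]) x :
  (forall i, chas_pd D a (F i) x (l i)) ->
  chas_pd D a (fun y => \sum_(i <- r) F i y) x (\sum_(i <- r) l i).
Proof.
move=> Fl; elim: r => [|i r IH].
  rewrite big_nil; under eq_fun do rewrite big_nil; exact: chas_pd_cst.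
by rewrite big_cons; under eq_fun do rewrite big_cons; exact: chas_pdD.
Qed.

Lemma chas_pd_cpow D a (rho : 'rV[R]_m -> R) s x l : 0 < rho x ->
  has_pd D a rho x l ->
  chas_pd D a (fun y => cpow (rho y) s) x (s * (l / rho x)%:C * cpow (rho x) s).
Proof.
move=> rho0 rl; have Ll : has_pd D a (fun y => ln (rho y)) x ((rho x)^-1 * l).
  by apply: (has_pd_comp1 (phi := @ln R)) rl; exact: is_derive1_ln.
have cL c : has_pd D a (fun y => c * ln (rho y)) x (c * ((rho x)^-1 * l)).
  apply: has_pd_eq (has_pdM (has_pd_cst D a c x) Ll) _.
  by rewrite mul0r add0r.
pose e := complex.Re s * ln (rho x); pose t := complex.Im s * ln (rho x).
have He : has_pd D a (fun y => expR (complex.Re s * ln (rho y))) x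
    (expR e * (complex.Re s * ((rho x)^-1 * l))).
  by apply: (has_pd_comp1 (phi := @expR R)) (cL _); exact: is_derive_expR.
have Hc : has_pd D a (fun y => cos (complex.Im s * ln (rho y))) x
    (- sin t * (complex.Im s * ((rho x)^-1 * l))).
  by apply: (has_pd_comp1 (phi := @cos R)) (cL _); exact: is_derive_cos.
have Hs : has_pd D a (fun y => sin (complex.Im s * ln (rho y))) x
    (cos t * (complex.Im s * ((rho x)^-1 * l))).
  by apply: (has_pd_comp1 (phi := @sin R)) (cL _); exact: is_derive_sin.
have H1 : chas_pd D a (fun y => (expR (complex.Re s * ln (rho y)))%:C) x _ := chas_pd_real He.
have H2 : chas_pd D a (fun y => cos (complex.Im s * ln (rho y)) +i*
   sin (complex.Im s * ln (rho y))) x ((- sin t * (complex.Im s * ((rho x)^-1 * l)))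
     +i* (cos t * (complex.Im s * ((rho x)^-1 * l)))) by split.
have := chas_pdM H1 H2; congr chas_pd; rewrite /cpow -/e -/t.
by apply: complex_ext; rewrite !(cReD, cImD, cReM, cImM) /=; ring.
Qed.

Lemma cpowD (r : R) (s t : R[i]) : cpow r (s + t) = cpow r s * cpow r t.
Proof.
rewrite /cpow; apply: complex_ext; rewrite !(cReD, cImD, cReM, cImM) /=;
  rewrite !mulrDl expRD cosD sinD; ring.
Qed.

Lemma cpow1 (r : R) : 0 < r -> cpow r 1 = r%:C.
Proof. by move=> r0; rewrite /cpow /= mul1r mul0r cos0 sin0 lnK // mulr1. Qed.

Lemma cpow0 (r : R) : cpow r 0 = 1.
Proof. by rewrite /cpow /= !mul0r cos0 sin0 expR0 mulr1. Qed.

End ComplexDerivatives.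

(** * Restriction to smaller domains, and the Laplacian in terms of jets *)

Section Locality.
Variables (R : realType) (m : nat).
Implicit Types (D E : set 'rV[R]_m) (f g : 'rV[R]_m -> R) (x y z : 'rV[R]_m) (a b : 'I_m).

(** Equivalent to [E] being a relatively open subset of [D]; in this form it says directly that the
    admissible steps at points of [E] agree. *)
Definition locally_eq D E := forall x, E x -> nbhs x (fun y : 'rV[R]_m => D y <-> E y).

Lemma has_pd_local D E f g a x l : locally_eq D E -> {in E, f =1 g} -> E x ->
  has_pd D a f x l -> has_pd E a g x l.
Proof.
move=> DE fg Ex H; apply: has_pd_near (has_pd_steps (DE _ Ex) H) => //.
by near=> y => Ey; apply: fg; rewrite inE.
Unshelve. all: by end_near. Qed.

Lemma pd_local D E f g a x : locally_eq D E -> {in E, f =1 g} -> E x ->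
  pd D a f x = pd E a g x.
Proof.
move=> DE fg Ex; rewrite /pd (steps_eq a (DE _ Ex)).
have nE : \forall t \near steps E a x, diffquot f a x t = diffquot g a x t.
  near=> t; rewrite /diffquot (fg x) ?inE // -/(axis a x t) fg // inE.
  by near: t; exact: steps_in.
suff -> : diffquot f a x @ steps E a x = diffquot g a x @ steps E a x by [].
apply/predeqP => P; split => nP; rewrite /fmap /= in nP *.
  by apply: filterS2 nE nP => t /= <-.
by apply: filterS2 nE nP => t /= ->.
Unshelve. all: by end_near. Qed.

Lemma Ck_local k D E f g : locally_eq D E -> {in E, f =1 g} -> Ck k D f -> Ck k E g.
Proof.
move=> DE; have ED x : E x -> D x by move=> Ex; have [_] := nbhs_singleton (DE _ Ex); apply.
elim: k f g => [|k IH] f g fg cf.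
  split=> //; have [/subspace_continuousP cf0 _] := cf.
  suff H x : E x -> g y @[y --> within E (nbhs x)] --> g x by exact/subspace_continuousP.
  move=> Ex.
  have <- : f x = g x by apply: fg; rewrite inE.
  have fE : f y @[y --> within E (nbhs x)] --> f x.
    apply: (cvg_trans _ (cf0 x (ED _ Ex))).
    by apply: cvg_app; apply: within_subset => y; exact: ED.
  apply: cvg_trans fE; apply: near_eq_cvg; rewrite near_withinE; near=> y => Ey.
  by rewrite fg ?inE.
have [cf0 cfS] := cf; split; first exact: Ck_continuous (IH _ _ fg (Ck_S cf)).
move=> a; split=> [x Ex|].
  apply/cvg_ex; exists (pd D a f x); apply: (has_pd_local DE fg Ex).
  by apply: Ck_has_pd cf _; exact: ED.
apply: (IH (pd D a f)); last exact: Ck_pd.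
by move=> x; rewrite inE => Ex; exact: pd_local.
Unshelve. all: by end_near. Qed.

Lemma laplacian_local D E G f g x : locally_eq D E -> {in E, f =1 g} -> E x ->
  laplacian D G f x = laplacian E G g x.
Proof.
move=> DE fg Ex; rewrite /laplacian /codiff; congr (- - _).
apply: eq_bigr => a _; apply: eq_bigr => b _; congr (_ * (_ - _)).
  by apply: pd_local => // y; rewrite inE => Ey; exact: pd_local.
apply: eq_bigr => c _; rewrite (pd_local c DE fg) //; congr (_ * _).
rewrite /christoffel; congr (_ * _); apply: eq_bigr => d _; congr (_ * (_ + _ - _));
  exact: pd_local.
Qed.

Lemma laplacianE D G f x : laplacian D G f x = plap (invmx (G x))
  (fun a => \matrix_(b, d) pd D a (fun z => G z b d) x)
  (fun a => pd D a f x) (fun a b => pd D a (pd D b f) x).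
Proof.
rewrite /laplacian /codiff opprK; apply: eq_bigr => a _; apply: eq_bigr => b _.
congr (_ * (_ - _)); apply: eq_bigr => c _; congr (_ * _); rewrite /christoffel /chr.
by congr (_ * _); apply: eq_bigr => d _; rewrite /low_chr !mxE.
Qed.

Definition clap D G (v : 'rV[R]_m -> R[i]) x : R[i] :=
  laplacian D G (fun y => complex.Re (v y)) x
  +i* laplacian D G (fun y => complex.Im (v y)) x.

Lemma clapE D G v x : clap D G v x = plap (map_mx (real_complex R) (invmx (G x)))
  (fun a => map_mx (real_complex R) (\matrix_(b, d) pd D a (fun z => G z b d) x))
  (fun a => cpd D a v x) (fun a b => cpd D a (cpd D b v) x).
Proof.
rewrite /clap !laplacianE [LHS]complexE /= !(plap_map (real_complex R)) -plapZ -plapD.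
by apply: plap_ext => [a|a b]; rewrite [RHS]complexE.
Qed.

End Locality.

(** * The identity at interior points *)

Section Chain.
Variables (R : realType) (m : nat) (o : 'I_m).

Lemma Ck_cst k (D : set 'rV[R]_m) (c : R) : hopen o D -> Ck k D (cst c).
Proof.
move=> hD; have cc (e : R) : {within D, continuous (cst e : 'rV[R]_m -> R)}.
  by apply/subspace_continuousP => x Dx; exact: cvg_cst.
elim: k c => [|k IH] c; split=> //.
move=> a; split=> [x Dx|]; first by apply/cvg_ex; exists 0; exact: has_pd_cst.
apply: (@Ck_local _ _ k D D (cst 0)) => //; first by move=> x Dx; near=> y.
move=> x; rewrite inE => Dx; apply/esym/has_pd_pd; last exact: has_pd_cst.
exact: (hopen_proper a hD Dx).
Unshelve. all: by end_near. Qed.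

Lemma chas_pd_chain D p (E : set 'rV[R]_p) (F : 'rV[R]_p -> 'rV[R]_m) (U : 'rV[R]_m -> R[i])
    (a : 'I_p) (x : 'rV[R]_p) (d : 'I_m -> R) :
  hopen o D -> Ck 1 D (fun z => complex.Re (U z)) -> Ck 1 D (fun z => complex.Im (U z)) ->
  E x -> (forall v, E v -> D (F v)) ->
  (forall k, has_pd E a (fun v => F v 0 k) x (d k)) ->
  chas_pd E a (fun v => U (F v)) x (\sum_k (d k)%:C * cpd D k U (F x)).
Proof.
move=> hD cr ci Ex EF dF; split.
  apply: has_pd_eq (has_pd_chain hD cr Ex EF dF) _.
  rewrite (big_morph _ (@cReD R) (erefl _)); apply: eq_bigr => k _.
  by rewrite cReM /= mul0r subr0 mulrC.
apply: has_pd_eq (has_pd_chain hD ci Ex EF dF) _.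
rewrite (big_morph _ (@cImD R) (erefl _)); apply: eq_bigr => k _.
by rewrite cImM /= mul0r addr0 mulrC.
Qed.

End Chain.

Section Interior.
Variables (R : realType) (n : nat).
Let o : 'I_(1 + n) := lshift n ord0.
Definition radial (A : 'M[R]_n) : 'M[R]_(1 + n) := block_mx 1%:M 0 0 A.

Lemma radial_entry (P : (('rV[R]_(1 + n)) -> R) -> Prop) (h : 'rV[R]_(1 + n) -> 'M[R]_n) b d :
  (forall c, P (cst c)) -> (forall k l, P (fun z => h z k l)) ->
  P (fun z => radial (h z) b d).
Proof.
move=> Pc Ph.
case: (split_ordP b) => k ->; case: (split_ordP d) => l ->; rewrite /radial.
- by under eq_fun do rewrite block_mxEul; exact: Pc.
- by under eq_fun do rewrite block_mxEur; exact: Pc.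
- by under eq_fun do rewrite block_mxEdl; exact: Pc.
- by under eq_fun do rewrite block_mxEdr; exact: Ph.
Qed.

Definition dradial D (h : 'rV[R]_(1 + n) -> 'M[R]_n) y (a : 'I_(1 + n)) : 'M[R]_(1 + n) :=
  \matrix_(b, d) pd D a (fun z => radial (h z) b d) y.

Lemma radial_Ck k D (h : 'rV[R]_(1 + n) -> 'M[R]_n) b d : hopen o D ->
  (forall i j, Ck k D (fun z => h z i j)) -> Ck k D (fun z => radial (h z) b d).
Proof.
by move=> hD ch; apply: (@radial_entry (Ck k D)) => [c|//]; exact: Ck_cst hD.
Qed.

Lemma dradial0 D h y a : hopen o D -> D y ->
  (forall b, dradial D h y a b o = 0) /\ (forall b, dradial D h y a o b = 0).
Proof.
move=> hD Dy; have P := hopen_proper a hD Dy; split=> b; rewrite mxE.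
  rewrite (_ : (fun z => _) = cst ((b == o)%:R)) ?(has_pd_pd P (@has_pd_cst _ _ D a _ y)) //.
  apply/funext => z; case: (split_ordP b) => k ->; rewrite /radial /o.
    by rewrite block_mxEul mxE !ord1 !eqxx.
  by rewrite block_mxEdl mxE eq_rlshift.
rewrite (_ : (fun z => _) = cst ((o == b)%:R)) ?(has_pd_pd P (@has_pd_cst _ _ D a _ y)) //.
by apply/funext => z; exact: radial_row.
Qed.

Lemma half_trace D h y : hopen o D -> D y -> h y \in unitmx -> (h y)^T = h y ->
  2^-1 * \tr (invmx (h y) *m \matrix_(a, b) pd D o (fun z => h z a b) y) =
  plap (invmx (radial (h y))) (dradial D h y) (fun a => (a == o)%:R) (fun _ _ => 0).
Proof.
move=> hD Dy hU hT; rewrite plap_radial //; last 2 first.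
- by move=> a b; have [] := dradial0 h a hD Dy.
- by move=> a b; have [_] := dradial0 h a hD Dy.
congr (_ * \tr (_ *m _)); apply/matrixP => a b; rewrite !mxE; congr pd.
by apply/funext => z; rewrite /radial block_mxEdr.
Qed.

Variables (D D' : set 'rV[R]_(1 + n)) (F : 'rV[R]_(1 + n) -> 'rV[R]_(1 + n)).
Variables (h hh : 'rV[R]_(1 + n) -> 'M[R]_n) (U : 'rV[R]_(1 + n) -> R[i]).
Hypotheses (hD : hopen o D) (hD' : hopen o D').
Hypotheses (FD : forall y, D y -> D' (F y)).
Hypotheses (Dpos : forall y, D y -> 0 < y 0 o) (Fpos : forall y, D y -> 0 < F y 0 o).
Hypotheses (Fsm : forall b, Ck 2 D (fun y => F y 0 b)).
Hypotheses (hsm : forall a b, Ck 1 D (fun y => h y a b)).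
Hypotheses (hhsm : forall a b, Ck 1 D' (fun y => hh y a b)).
Hypotheses (hU : forall y, D y -> h y \in unitmx) (hT : forall y, D y -> (h y)^T = h y).
Hypotheses (hhU : forall y, D' y -> hh y \in unitmx) (hhT : forall y, D' y -> (hh y)^T = hh y).
Hypotheses (Usm1 : Ck 2 D' (fun z => complex.Re (U z))) (Usm2 : Ck 2 D' (fun z => complex.Im (U z))).
Let rho z := F z 0 o / z 0 o.
Hypothesis Fh : forall y, D y ->
  Defs.jacobian D F y *m radial (hh (F y)) *m (Defs.jacobian D F y)^T = rho y ^+ 2 *: radial (h y).

Let Jf b k z := pd D b (fun w => F w 0 k) z.
Let dL a z := Jf a o z / F z 0 o - (a == o)%:R / z 0 o.
Let UU b z := \sum_k (Jf b k z)%:C * cpd D' k U (F z).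

Let hasF a b z : D z -> has_pd D a (fun w => F w 0 b) z (Jf a b z).
Proof. by move=> Dz; exact: Ck_has_pd (Fsm b) Dz. Qed.

Let hasJ a b k z : D z -> has_pd D a (Jf b k) z (pd D a (Jf b k) z).
Proof. by move=> Dz; exact: Ck_has_pd (Ck_pd b (Fsm k)) Dz. Qed.

Let has_inv (f : 'rV[R]_(1 + n) -> R) a z l : f z != 0 -> has_pd D a f z l ->
  has_pd D a (fun w => (f w)^-1) z (- l / f z ^+ 2).
Proof.
move=> f0 fl.
by apply: has_pd_eq (has_pd_comp1 (is_derive_invr f0) fl) _; rewrite mulNr mulrC mulNr.
Qed.

Let has_rho a z : D z -> has_pd D a rho z (rho z * dL a z).
Proof.
move=> Dz; have z0 := lt0r_neq0 (Dpos Dz); have F0 := lt0r_neq0 (Fpos Dz).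
have H := has_pdM (@hasF a o _ Dz) (has_inv z0 (@has_pd_coord _ _ D a o z)).
apply: (has_pd_eq H).
by rewrite /rho /dL eq_sym; field; rewrite z0 F0.
Qed.

Let has_dL a b y : D y -> has_pd D a (dL b) y (pd D a (Jf b o) y / F y 0 o
  - Jf a o y * Jf b o y / F y 0 o ^+ 2 + (a == o)%:R * (b == o)%:R / y 0 o ^+ 2).
Proof.
move=> Dy; have y0 := lt0r_neq0 (Dpos Dy); have F0 := lt0r_neq0 (Fpos Dy).
have H1 := has_pdM (@hasJ a b o _ Dy) (has_inv F0 (@hasF a o _ Dy)).
have H2 := has_pdN (has_pdM (@has_pd_cst _ _ D a ((b == o)%:R : R) y) (has_inv y0 (@has_pd_coord _ _ D a o y))).
apply: (has_pd_eq (has_pdD H1 H2)).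
by rewrite (eq_sym o a) /=; field; rewrite y0 F0.
Qed.

Variables (s : R[i]).
Let E z := cpow (rho z) s.
Let v z := E z * U (F z).
Let vv b z := E z * (s * (dL b z)%:C * U (F z) + UU b z).

Let rho_gt0 z : D z -> 0 < rho z.
Proof. by move=> Dz; apply: divr_gt0; [exact: Fpos|exact: Dpos]. Qed.

Let has_E a z : D z -> chas_pd D a E z (E z * (s * (dL a z)%:C)).
Proof.
move=> Dz; have := chas_pd_cpow s (rho_gt0 Dz) (@has_rho a _ Dz).
rewrite [rho z * _]mulrC mulfK ?gt_eqF ?rho_gt0 //.
by congr chas_pd; rewrite mulrC.
Qed.

Let has_U a z : D z -> chas_pd D a (fun w => U (F w)) z (UU a z).
Proof.
by move=> Dz; apply: (chas_pd_chain hD' (Ck_S Usm1) (Ck_S Usm2)) => // k; exact: hasF.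
Qed.

Let has_v b z : D z -> chas_pd D b v z (vv b z).
Proof.
move=> Dz; have := chas_pdM (@has_E b _ Dz) (@has_U b _ Dz); congr chas_pd.
by rewrite /vv; ring.
Qed.

Let cpd_v b z : D z -> cpd D b v z = vv b z.
Proof. by move=> Dz; apply: chas_pd_cpd (@has_v b _ Dz); exact: (hopen_proper b hD Dz). Qed.

Let has_UU a b y : D y -> chas_pd D a (UU b) y (\sum_k ((pd D a (Jf b k) y)%:C * cpd D' k U (F y)
   + (Jf b k y)%:C * \sum_l (Jf a l y)%:C * cpd D' l (cpd D' k U) (F y))).
Proof.
move=> Dy; apply: chas_pd_sum => k; apply: chas_pdM.
  exact/chas_pd_real/hasJ.
apply: (chas_pd_chain hD') => //; [exact: Ck_pd Usm1|exact: Ck_pd Usm2|].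
by move=> l; exact: hasF.
Qed.

(** All jets are computed in coordinates and substituted in [shift_identity] over [R[i]]; the trace
    terms enter as Laplacians of $r$ through [half_trace]. *)
Lemma interior_identity y : D y ->
  (y 0 o)%:C * clap D (radial \o h) v y + (2 * s - n%:R + 1) * cpd D o v y
    + s * (2^-1 * \tr (invmx (h y) *m \matrix_(a, b) pd D o (fun z => h z a b) y))%:C * v y =
  (rho y)%:C * E y *
  ((F y 0 o)%:C * clap D' (radial \o hh) U (F y) + (2 * s - n%:R + 1) * cpd D' o U (F y)
    + s * (2^-1 * \tr (invmx (hh (F y)) *m
         \matrix_(a, b) pd D' o (fun z => hh z a b) (F y)))%:C * U (F y)).
Proof.
move=> Dy; have D'y := FD Dy; have y0 := lt0r_neq0 (Dpos Dy); have F0 := lt0r_neq0 (Fpos Dy).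
(* Since $r>0$ at [y], a relatively open set is a full neighbourhood, as [schwarz] requires. *)
have nD : nbhs y D.
  have [_ H] := hD Dy; have o0 : nbhs y (fun z : 'rV[R]_(1 + n) => 0 < z 0 o).
    have cy : (fun z : 'rV[R]_(1 + n) => z 0 o) @ y --> y 0 o by exact: coord_continuous.
    exact: (cvgr_gt (y 0 o) cy 0 (Dpos Dy)).
  by apply: filterS2 H o0 => z Hz z0; apply: Hz; exact: ltW.
pose qv a b := E y * (s * (dL a y)%:C * (s * (dL b y)%:C * U (F y) + UU b y)
  + s * (pd D a (Jf b o) y / F y 0 o - Jf a o y * Jf b o y / F y 0 o ^+ 2
         + (a == o)%:R * (b == o)%:R / y 0 o ^+ 2)%:C * U (F y)
  + s * (dL b y)%:C * UU a y + \sum_k ((pd D a (Jf b k) y)%:C * cpd D' k U (F y)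
   + (Jf b k y)%:C * \sum_l (Jf a l y)%:C * cpd D' l (cpd D' k U) (F y))).
(* The first derivative of [v] equals [vv] on all of [D], so second derivatives are obtained by
   differentiating that formula. *)
have cpd_vv a b : cpd D a (cpd D b v) y = qv a b.
  have P := hopen_proper a hD Dy; apply: (chas_pd_cpd P).
  apply: (@chas_pd_near _ _ D a (vv b) (cpd D b v)) => //.
    by near=> z => Dz; rewrite cpd_v.
  have HdL := chas_pd_real (@has_dL a b _ Dy).
  have Hin := chas_pdD (chas_pdM (chas_pdM (chas_pd_cst D a s y) HdL) (@has_U a _ Dy))
    (@has_UU a b _ Dy).
  have := chas_pdM (@has_E a _ Dy) Hin.
  by congr chas_pd; rewrite /qv; ring.
have hyU := hU Dy; have hyT := hT Dy; have hhyU := hhU D'y; have hhyT := hhT D'y.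
have CS a b k : pd D a (Jf b k) y = pd D b (Jf a k) y
  := schwarz a b (Fsm k) nD.
(* The first derivative of the identity [Fh], which holds on all of [D]; the left-hand side uses
   $d\rho = \rho\,dL$. *)
have dFh a b d : rho y ^+ 2 * (dradial D h y a b d + 2 * dL a y * radial (h y) b d) =
  \sum_k \sum_l (pd D a (Jf b k) y * radial (hh (F y)) k l * Jf d l y
    + Jf b k y * (\sum_e Jf a e y * dradial D' hh (F y) e k l) * Jf d l y
    + Jf b k y * radial (hh (F y)) k l * pd D a (Jf d l) y).
  have P := hopen_proper a hD Dy.
  have HG : has_pd D a (fun z => radial (h z) b d) y (dradial D h y a b d).
    by rewrite mxE; apply: Ck_has_pd (radial_Ck _ _ hD hsm) Dy.
  have HrG := has_pdM (has_pdM (@has_rho a _ Dy) (@has_rho a _ Dy)) HG.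
  have HhG k l : has_pd D a (fun z => radial (hh (F z)) k l) y
      (\sum_e dradial D' hh (F y) e k l * Jf a e y).
    apply: has_pd_eq (has_pd_chain hD' (radial_Ck k l hD' hhsm) Dy FD (fun e => @hasF a e _ Dy)) _.
    by apply: eq_bigr => e _; rewrite mxE.
  have HS : has_pd D a (fun z => \sum_k \sum_l Jf b k z * radial (hh (F z)) k l * Jf d l z) y _
    := has_pd_sum (fun k => has_pd_sum (fun l =>
         has_pdM (has_pdM (@hasJ a b k _ Dy) (HhG k l)) (@hasJ a d l _ Dy))).
  have e1 := has_pd_pd P HrG; have e2 := has_pd_pd P HS.
  transitivity (pd D a (fun z => rho z * rho z * radial (h z) b d) y).
    by rewrite e1; ring.
  transitivity (pd D a (fun z => \sum_k \sum_l Jf b k z * radial (hh (F z)) k l * Jf d l z) y).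
    apply: (@pd_local _ _ D D) => //; first by move=> z Dz; near=> w.
    move=> z; rewrite inE => Dz; have /matrixP /(_ b d) := Fh Dz.
    rewrite !mxE -expr2 => <-; rewrite exchange_big; apply: eq_bigr => l _.
    rewrite !mxE mulr_suml; apply: eq_bigr => k _; by rewrite mxE.
  rewrite e2; apply: eq_bigr => k _; apply: eq_bigr => l _.
  rewrite mulrDl; congr (_ + _ * _ * _ + _).
  by apply: eq_bigr => e _; exact: mulrC.
rewrite !half_trace // !clapE !(plap_map (real_complex R)).
have prE m (Gi : 'M[R[i]]_m) dG (k : 'I_m) :
    plap Gi dG (fun a => ((a == k)%:R)%:C) (fun _ _ => 0%:C) =
    plap Gi dG (fun a => (a == k)%:R) (fun _ _ => 0).
  by apply: plap_ext => [a|a b]; rewrite ?rmorph_nat ?rmorph0.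
have vE : v y = E y * U (F y) by [].
have rhoE : (rho y)%:C = (F y 0 o)%:C / (y 0 o)%:C by rewrite -fmorph_div.
have mapE (A : 'M[R]_(1 + n)) i j : map_mx (real_complex R) A i j = (A i j)%:C by rewrite mxE.
have JE a k : Defs.jacobian D F y a k = Jf a k y by rewrite mxE.
have dLE a : (Defs.jacobian D F y a o)%:C / (F y 0 o)%:C - (a == o)%:R / (y 0 o)%:C = (dL a y)%:C.
  by rewrite JE /dL rmorphB !fmorph_div rmorph_nat.
rewrite !prE vE rhoE.
apply: (@shift_identity _ _ n o (map_mx (real_complex R) (radial (h y))) _ (map_mx (real_complex R) (radial (hh (F y)))) _
  (map_mx (real_complex R) (Defs.jacobian D F y)) _ _ (fun a b k => (pd D a (Jf b k) y)%:C)
  ((y 0 o)%:C) ((F y 0 o)%:C) _ _ _ _ _ _ _ _ _ _ _ _ _ _ s (E y) (U (F y))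
  (fun a => cpd D' a U (F y)) (fun a => UU a y) (fun a => cpd D a v y)
  (fun a b => cpd D' a (cpd D' b U) (F y))
  (fun a b => \sum_k ((pd D a (Jf b k) y)%:C * cpd D' k U (F y)
   + (Jf b k y)%:C * \sum_l (Jf a l y)%:C * cpd D' l (cpd D' k U) (F y)))
  (fun a b => cpd D a (cpd D b v) y)).
- by rewrite pnatr_eq0.
- by rewrite fmorph_eq0.
- by rewrite fmorph_eq0.
- by [].
- by rewrite -map_mxM mulmxV ?map_mx1 // radial_unit.
- by rewrite map_trmx radial_sym.
- by rewrite map_trmx invmx_radial_sym.
- by rewrite -map_mxM mulmxV ?map_mx1 // radial_unit.
- by rewrite map_trmx radial_sym.
- by move=> b; rewrite mxE invmx_radial // radial_row rmorph_nat.
- by move=> b; rewrite mxE invmx_radial // radial_row rmorph_nat.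
- by move=> a b k; rewrite CS.
- by rewrite map_trmx -!map_mxM Fh // map_mxZ rmorphXn -rhoE.
- move=> a b d; have := congr1 (real_complex R) (dFh a b d).
  rewrite rmorphM rmorphXn /= rhoE rmorphD !rmorphM rmorph_nat /= -dLE !mapE => H.
  apply: etrans (etrans H _); first by rewrite [dradial _ _ _ _ _ _]mxE [(\matrix_(_, _) _) _ _]mxE.
  apply: etrans (rmorph_sum (real_complex R) _ _ _) _; apply: eq_bigr => k _.
  apply: etrans (rmorph_sum (real_complex R) _ _ _) _; apply: eq_bigr => l _.
  rewrite !rmorphD !rmorphM rmorph_sum !mapE !JE.
  congr (_ * _ * _ + _ * _ * _ + _).
  by apply: eq_bigr => e _; rewrite rmorphM !mapE JE !mxE.
- by move=> a; apply: eq_bigr => k _; rewrite mapE JE.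
- move=> a b; apply: eq_bigr => k _; rewrite mapE JE; congr (_ + _ * _).
  by apply: eq_bigr => l _; rewrite mapE JE.
- by move=> a; rewrite cpd_v // mapE dLE.
- move=> a b; rewrite cpd_vv !mapE !dLE; congr (_ * (_ + _ * _ * _ + _ + _)).
  by rewrite rmorphD rmorphB !fmorph_div !rmorphXn !rmorphM !rmorph_nat !JE /=.
Unshelve. all: by end_near. Qed.

End Interior.

(** * The identity at boundary points *)

Section Boundary.
Variables (R : realType) (n : nat).
Let o : 'I_(1 + n) := lshift n ord0.
Variables (D D' : set 'rV[R]_(1 + n)) (F : 'rV[R]_(1 + n) -> 'rV[R]_(1 + n)).
Variables (h hh : 'rV[R]_(1 + n) -> 'M[R]_n).
Hypotheses (n0 : (0 < n)%N) (hD : hopen o D) (hD' : hopen o D').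
Hypotheses (FD : forall y, D y -> D' (F y)).
Hypotheses (Fsm : forall b, Ck 2 D (fun y => F y 0 b)).
Hypotheses (hsm : forall a b, Ck 1 D (fun y => h y a b)).
Hypotheses (hhsm : forall a b, Ck 1 D' (fun y => hh y a b)).
Hypotheses (Fpos : forall y, D y -> 0 < y 0 o -> 0 < F y 0 o).
Hypotheses (F0 : forall y, D y -> y 0 o = 0 -> F y 0 o = 0).
Hypothesis Fh : forall y, D y -> 0 < y 0 o ->
  Defs.jacobian D F y *m radial (hh (F y)) *m (Defs.jacobian D F y)^T
  = (F y 0 o / y 0 o) ^+ 2 *: radial (h y).
Variable (y : 'rV[R]_(1 + n)).
Hypotheses (Dy : D y) (y0 : y 0 o = 0).
Hypotheses (hhU : hh (F y) \in unitmx) (JU : drsubmx (Defs.jacobian D F y) \in unitmx).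

Let Jf b k z := pd D b (fun w => F w 0 k) z.
Let S := steps D o y.
Let P : ProperFilter S := hopen_proper o hD Dy.
Let z (t : R) := axis o y t.
Let q t := F (z t) 0 o / t.

Let zo t : z t 0 o = t.
Proof. by rewrite axisE y0 eqxx mul1r add0r. Qed.

(** At a boundary point only positive steps in the $r$-direction are admissible, so [Fh] is
    available all along [S]. *)
Let S_gt0 : \forall t \near S, 0 < t /\ D (z t).
Proof.
near=> t; have Dt : D (z t) by near: t; exact: steps_in.
have t0 : t != 0 by near: t; exact: steps_neq0.
have [] := hD Dt; rewrite zo => tge0 _; split=> //.
by rewrite lt_neqAle eq_sym t0.
Unshelve. all: by end_near. Qed.

Let Ck_S_cvg k g : Ck k D g -> g (z t) @[t --> S] --> g y.
Proof.
move=> cg A /(Ck_cvg cg Dy) nA.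
have H : \forall w \near y, D w -> A (g w) by exact: nA.
exact: (near_steps o H).
Qed.

Let cvg_J a k : Jf a k (z t) @[t --> S] --> Jf a k y.
Proof. by apply: (Ck_S_cvg (k := 1)); exact: Ck_pd (Fsm k). Qed.

Let cvg_hh k l : hh (F (z t)) k l @[t --> S] --> hh (F y) k l.
Proof.
apply: (@has_pd_continuous _ _ D o (fun w => hh (F w) k l) y).
apply: (has_pd_chain hD' (hhsm k l) Dy FD) => b.
exact: Ck_has_pd (Fsm b) Dy.
Qed.


Let Fyo : F y 0 o = 0. Proof. exact: F0. Qed.

Let cvg_q : q t @[t --> S] --> Jf o o y.
Proof.
have H : has_pd D o (fun w => F w 0 o) y (Jf o o y) := Ck_has_pd (Fsm o) Dy.
apply: (steps_lim H) => t _ _.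
by rewrite /diffquot Fyo subr0.
Qed.

Let J_tangential j : Jf (rshift 1 j) o y = 0.
Proof.
have Pj := hopen_proper (rshift 1 j) hD Dy.
apply: (has_pd_pd Pj); apply: (@has_pd_lim _ _ _ _ _ _ _ (fun=> 0)); first exact: cvg_cst.
move=> t _ Dt; rewrite /diffquot -/(axis _ _ _) Fyo F0 ?subrr ?mul0r //.
by rewrite axisE y0 add0r /o eq_lrshift mul0r.
Qed.

Let entry t a b : 0 < t -> D (z t) ->
  Jf a o (z t) * Jf b o (z t) + \sum_k \sum_l Jf a (rshift 1 k) (z t) * hh (F (z t)) k l
    * Jf b (rshift 1 l) (z t) = q t ^+ 2 * radial (h (z t)) a b.
Proof.
move=> t0 Dt; have zt0 : 0 < z t 0 o by rewrite zo.
have /matrixP /(_ a b) := Fh Dt zt0; rewrite zo -/(q t) [RHS]mxE => <-.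
have JB l : (Defs.jacobian D F (z t) *m radial (hh (F (z t)))) a l =
    \sum_k Jf a k (z t) * radial (hh (F (z t))) k l.
  by rewrite mxE; apply: eq_bigr => k _; rewrite mxE.
have JT l : (Defs.jacobian D F (z t))^T l b = Jf b l (z t) by rewrite !mxE.
rewrite mxE; under [RHS]eq_bigr do rewrite JB JT.
symmetry.
rewrite big_split_ord /= big_ord1 -/o; congr (_ + _).
  rewrite big_split_ord /= big_ord1 -/o big1 ?addr0 => [|k _].
    by rewrite radial_row eqxx mulr1.
  by rewrite /radial block_mxEdl mxE mulr0.
rewrite exchange_big; apply: eq_bigr => l _; rewrite -mulr_suml; congr (_ * _).
rewrite big_split_ord /= big_ord1 -/o radial_row /o eq_lrshift mulr0 add0r.
by apply: eq_bigr => k _; rewrite /radial block_mxEdr.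
Qed.

(** [Fh] says nothing at $r=0$, but both of its sides converge along [S]: the left by continuity,
    the right because $f/r$ tends to $\partial_rf$. *)
Let entry_lim a b : Jf a o y * Jf b o y
  + \sum_k \sum_l Jf a (rshift 1 k) y * hh (F y) k l * Jf b (rshift 1 l) y
  = Jf o o y ^+ 2 * radial (h y) a b.
Proof.
have L1 : (Jf a o (z t) * Jf b o (z t) + \sum_k \sum_l Jf a (rshift 1 k) (z t)
    * hh (F (z t)) k l * Jf b (rshift 1 l) (z t)) @[t --> S] -->
  Jf a o y * Jf b o y
  + \sum_k \sum_l Jf a (rshift 1 k) y * hh (F y) k l * Jf b (rshift 1 l) y.
  apply: cvgD; first by apply: cvgM; exact: cvg_J.
  apply: cvg_sumr => k; apply: cvg_sumr => l; apply: cvgM; last exact: cvg_J.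
  by apply: cvgM; [exact: cvg_J|exact: cvg_hh].
have L2 : (q t * q t * radial (h (z t)) a b) @[t --> S] -->
    Jf o o y * Jf o o y * radial (h y) a b.
  apply: cvgM; first by apply: cvgM; exact: cvg_q.
  exact: Ck_S_cvg (radial_Ck a b hD hsm).
have PS : ProperFilter S := P.
have L3 := cvg_lim (@Rhausdorff R) L2; rewrite expr2 -L3.
apply/esym/cvg_lim; first exact: Rhausdorff.
apply: near_cvg L1; near=> t.
have [t0 Dt] : 0 < t /\ D (z t) by near: t; exact: S_gt0.
by rewrite entry // expr2.
Unshelve. all: by end_near. Qed.

(** Let [c] be the tangential part of $dF(\partial_r)$ and [A] the tangential block of the Jacobian.
    The mixed entries of the limiting identity give $c\,\hat h\,A^T = 0$, because [f] has no
    tangential derivative; $\hat h$ and [A] are invertible. *)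
Let Jo k : Jf o (rshift 1 k) y = 0.
Proof.
pose A := drsubmx (Defs.jacobian D F y).
pose c : 'rV[R]_n := \row_k Jf o (rshift 1 k) y.
suff /rowP /(_ k) : c = 0 by rewrite !mxE.
have : c *m hh (F y) *m A^T = 0.
  apply/rowP => j; have := entry_lim o (rshift 1 j).
  rewrite J_tangential mulr0 add0r radial_row /o eq_lrshift mulr0 => H.
  rewrite [RHS]mxE; apply: (etrans _ H); rewrite mxE [RHS]exchange_big; apply: eq_bigr => l _.
  have -> : (c *m hh (F y)) 0 l = \sum_k Jf o (rshift 1 k) y * hh (F y) k l.
    by rewrite mxE; apply: eq_bigr => i _; rewrite mxE.
  by rewrite mulr_suml; apply: eq_bigr => i _; rewrite !mxE.
by move=> /(congr1 (mulmx^~ (invmx A^T))) /(congr1 (mulmx^~ (invmx (hh (F y)))));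
  rewrite !mul0mx -!mulmxA mulKVmx // ?unitmx_tr // mulmxV // mulmx1.
Qed.

(** The slope is a limit of positive quotients, hence nonnegative. If it were 0, the tangential
    entries of the limiting identity would give $A\hat hA^T = 0$, impossible for invertible matrices
    of positive size. *)
Lemma boundary_slope_gt0 : 0 < pd D o (fun w => F w 0 o) y.
Proof.
have PS : ProperFilter S := P.
have : 0 <= Jf o o y.
  rewrite -(cvg_lim (@Rhausdorff R) cvg_q); apply: limr_ge; first by apply/cvg_ex; exists (Jf o o y).
  near=> t; have [t0 Dt] : 0 < t /\ D (z t) by near: t; exact: S_gt0.
  by rewrite ltW // divr_gt0 // Fpos // zo.
rewrite le_eqVlt => /orP[/eqP J0|//]; exfalso.
pose A := drsubmx (Defs.jacobian D F y).
have : A *m hh (F y) *m A^T = 0.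
  apply/matrixP => i j; have := entry_lim (rshift 1 i) (rshift 1 j).
  rewrite !J_tangential mulr0 add0r -J0 expr0n mul0r => H.
  rewrite [RHS]mxE; apply: (etrans _ H); rewrite mxE [RHS]exchange_big; apply: eq_bigr => l _.
  have -> : (A *m hh (F y)) i l = \sum_k Jf (rshift 1 i) (rshift 1 k) y * hh (F y) k l.
    by rewrite mxE; apply: eq_bigr => k _; rewrite !mxE.
  by rewrite mulr_suml; apply: eq_bigr => k _; rewrite !mxE.
move=> AhA; have : A *m hh (F y) *m A^T \in unitmx.
  by rewrite !unitmx_mul JU hhU unitmx_tr.
by rewrite AhA; case: (n) n0 => // n' _; rewrite unitmxE det0 unitr0.
Unshelve. all: by end_near. Qed.

(* [df/dr] and [rho = f / r] differ by [- |c|^2 / (df/dr + rho)], where [c] is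
   the tangential part of [dF (d/dr)]; [c] is differentiable and vanishes at
   [r = 0]. *)
Let slope_defect : ((Jf o o (z t) - q t) / t) @[t --> S] --> (0 : R).
Proof.
have s0 := boundary_slope_gt0; rewrite -/(Jf o o y) in s0.
pose c k t := diffquot (Jf o (rshift 1 k)) o y t.
have cc k : c k t @[t --> S] --> pd D o (Jf o (rshift 1 k)) y.
  exact: Ck_has_pd (Ck_pd o (Fsm _)) Dy.
have L : (- (\sum_k \sum_l c k t * hh (F (z t)) k l * Jf o (rshift 1 l) (z t))
    * (Jf o o (z t) + q t)^-1) @[t --> S] -->
  - (\sum_k \sum_l pd D o (Jf o (rshift 1 k)) y * hh (F y) k l * Jf o (rshift 1 l) y)
    * (Jf o o y + Jf o o y)^-1.
  apply: cvgM.
    apply: cvgN; apply: cvg_sumr => k; apply: cvg_sumr => l; apply: cvgM; last exact: cvg_J.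
    by apply: cvgM; [exact: cc|exact: cvg_hh].
  apply: cvgV; first by rewrite gt_eqF // addr_gt0.
  by apply: cvgD; [exact: cvg_J|exact: cvg_q].
rewrite big1 ?oppr0 ?mul0r in L; last first.
  by move=> k _; rewrite big1 // => l _; rewrite Jo mulr0.
apply: near_cvg L; near=> t.
have [t0 Dt] : 0 < t /\ D (z t) by near: t; exact: S_gt0.
have q0 : 0 < q t by rewrite divr_gt0 // Fpos // zo.
have J0 : 0 < Jf o o (z t) by near: t; exact: (cvgr_gt (Jf o o y) (@cvg_J o o) 0 s0).
have := entry o o t0 Dt; rewrite radial_row eqxx mulr1.
have -> : \sum_k \sum_l Jf o (rshift 1 k) (z t) * hh (F (z t)) k l * Jf o (rshift 1 l) (z t) =
    t * \sum_k \sum_l c k t * hh (F (z t)) k l * Jf o (rshift 1 l) (z t).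
  rewrite mulr_sumr; apply: eq_bigr => k _; rewrite mulr_sumr; apply: eq_bigr => l _.
  by rewrite /c /diffquot Jo subr0 -/(z t); field; rewrite gt_eqF.
move: (\sum_k _) => Q HQ.
have -> : Q = (q t ^+ 2 - Jf o o (z t) ^+ 2) / t.
  by rewrite -HQ; field; rewrite gt_eqF.
by field; rewrite !gt_eqF // addr_gt0.
Unshelve. all: by end_near. Qed.

(** Along the axis [rho] is the quotient [q], whose derivative [(Jf o o (z t) - q t) / t] tends to
    0. A mean value between $t_1$ and $t$ bounds the variation of [q], and $t_1 \to 0$ brings in the
    boundary value. *)
Lemma boundary_rho (rho : 'rV[R]_(1 + n) -> R) : rho y = Jf o o y ->
  (forall w, D w -> 0 < w 0 o -> rho w = F w 0 o / w 0 o) -> has_pd D o rho y 0.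
Proof.
move=> rhoy rhoE; have PS : ProperFilter S := P.
apply/cvgrPdist_le => e e0.
have H1 : \forall t \near S, `|(Jf o o (z t) - q t) / t| <= e.
  have /cvgrPdist_le /(_ e e0) := slope_defect.
  by apply: filterS => t; rewrite sub0r normrN.
have H2 : nbhs (0 : R) (fun t => t != 0 -> D (z t) -> `|(Jf o o (z t) - q t) / t| <= e).
  move: H1; rewrite /S /steps near_withinE => H1.
  by move: H1; rewrite near_withinE.
have H3 : nbhs (0 : R) (fun t => 0 <= t -> D (z t)).
  have [_ nD] := hD Dy; have := @axis_continuous R _ o y 0 (fun w => 0 <= w 0 o -> D w).
  rewrite axis0 => /(_ nD) H; have {}H : \forall t \near (0 : R), 0 <= z t 0 o -> D (z t) by exact: H.
  by apply: filterS H => t; rewrite zo.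
have /nbhs_ballP[d /= d0 dB] : nbhs (0 : R) (fun t =>
    (t != 0 -> D (z t) -> `|(Jf o o (z t) - q t) / t| <= e) /\ (0 <= t -> D (z t))).
  exact: filterI H2 H3.
have good t : 0 < t -> t < d -> D (z t) /\ `|(Jf o o (z t) - q t) / t| <= e.
  move=> t0 td; have [] : (t != 0 -> D (z t) -> `|(Jf o o (z t) - q t) / t| <= e)
    /\ (0 <= t -> D (z t)).
    by apply: dB; rewrite /ball /= sub0r normrN gtr0_norm.
  by move=> A B; have Dt := B (ltW t0); split=> //; apply: A => //; rewrite gt_eqF.
have dq t : 0 < t -> t < d -> is_derive t 1 q ((Jf o o (z t) - q t) / t).
  move=> t0 td; have [Dt _] := good t t0 td.
  have nz : t != 0 by rewrite gt_eqF.
  have nDt : \forall r \near t, D (axis o y r).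
    near=> r; apply: (good r _ _).1; near: r; [exact: lt_nbhsr|exact: lt_nbhsl].
  have cF : cvg (diffquot (fun w => F w 0 o) o (z t) @ steps D o (z t)).
    by have [_ /(_ o)[+ _]] := Fsm o; apply.
  have dF := axis_derive nDt cF.
  have dinv := is_derive_invr nz.
  apply: (@is_derive_eq _ _ _ q t 1 _ _ (is_deriveM dF dinv)).
  rewrite /= /q -/(z t) [_ *: _]mulrC [_ *: (pd _ _ _ _)]mulrC -/(Jf o o (z t)).
  by field.
(* By [dq], [slope_defect] says that [q'] tends to [0]. *)
have mvt t1 t : 0 < t1 -> t1 < t -> t < d -> `|q t - q t1| <= e * t.
  move=> t10 t1t td.
  have [||r] := @MVT R q (fun t => (Jf o o (z t) - q t) / t) t1 t t1t.
  - move=> r; rewrite in_itv/= => /andP[r1 r2].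
    by apply: dq; [exact: lt_trans r1|exact: lt_trans td].
  - apply: derivable_within_continuous => r; rewrite in_itv/= => /andP[r1 r2].
    by have [] := dq r (lt_le_trans t10 r1) (le_lt_trans r2 td).
  - rewrite in_itv/= => /andP[r1 r2] ->; rewrite normrM.
    have [_ ge] := good r (lt_trans t10 r1) (lt_trans r2 td).
    rewrite (gtr0_norm (x := t - t1)) ?subr_gt0 //.
    by apply: ler_pM => //; [rewrite subr_ge0 ltW|rewrite gerBl ltW].
near=> t.
have [t0 Dt] : 0 < t /\ D (z t) by near: t; exact: S_gt0.
have td : t < d.
  by near: t; apply: (cvgr_lt (0 : R) (@steps_cvg0 _ _ D o y) d d0).
rewrite sub0r normrN /diffquot -/(z t) rhoy rhoE ?zo // -/(q t).
rewrite normrM normfV (gtr0_norm t0) ler_pdivrMr //.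
apply/ler_addgt0Pr => e' e'0.
(* A point $t_1 < t$ so close to 0 that replacing [q t1] by the boundary value costs at most the
   arbitrary [e']. *)
have nS : \forall t1 \near S, (0 < t1 /\ D (z t1)) /\ `|Jf o o y - q t1| < e' /\ t1 < t.
  apply: filterI; first exact: S_gt0; apply: filterI.
    by have /cvgrPdist_lt /(_ e' e'0) := cvg_q.
  exact: (cvgr_lt (0 : R) (@steps_cvg0 _ _ D o y) t t0).
have [t1] := @filter_ex _ S _ _ nS.
move=> [[t10 _] [qe t1t]].
rewrite (_ : q t - Jf o o y = (q t - q t1) - (Jf o o y - q t1)); last by ring.
apply: le_trans (ler_normB _ _) _; apply: lerD; first exact: mvt.
exact: ltW.
Unshelve. all: by end_near. Qed.

Lemma boundary_identity (rho : 'rV[R]_(1 + n) -> R) (U : 'rV[R]_(1 + n) -> R[i]) (s : R[i]) :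
  Ck 1 D' (fun w => complex.Re (U w)) -> Ck 1 D' (fun w => complex.Im (U w)) ->
  rho y = Jf o o y -> (forall w, D w -> 0 < w 0 o -> rho w = F w 0 o / w 0 o) ->
  cpd D o (fun w => cpow (rho w) s * U (F w)) y =
  cpow (rho y) s * (rho y)%:C * cpd D' o U (F y).
Proof.
move=> U1 U2 rhoy rhoE; have rho0 : 0 < rho y by rewrite rhoy boundary_slope_gt0.
have HE := chas_pd_cpow s rho0 (boundary_rho rhoy rhoE).
have HU := chas_pd_chain hD' U1 U2 Dy FD (fun k => Ck_has_pd (a := o) (Fsm k) Dy).
rewrite (chas_pd_cpd P (chas_pdM HE HU)) mul0r rmorph0 mulr0 !mul0r add0r.
rewrite big_split_ord /= big_ord1 -/o -/(Jf o o y) -rhoy big1 ?addr0 ?mulrA // => k _.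
by rewrite -/(Jf _ _ y) Jo rmorph0 mul0r.
Qed.

End Boundary.

(** * The cylinder over a manifold *)

Section PdTransfer.
Variables (R : realType) (m p : nat).

(** A partial derivative sees only a line, so it can be compared between spaces of different
    dimension. This identifies tangential derivatives on $r=0$ with derivatives in a chart of
    $M$. *)
Lemma pd_transfer (D : set 'rV[R]_m) (E : set 'rV[R]_p) f g a b x y : D x ->
  (forall t, D (axis a x t) <-> E (axis b y t)) ->
  (forall t, D (axis a x t) -> f (axis a x t) = g (axis b y t)) ->
  pd D a f x = pd E b g y.
Proof.
move=> Dx DE fg; have fgx : f x = g y by have := fg 0; rewrite !axis0; apply.
have sE : steps D a x = steps E b y.
  by rewrite /steps (_ : [set t | D _] = [set t | E (axis b y t)]) //; apply/predeqP.
rewrite /pd -sE; have nE : \forall t \near steps D a x, diffquot f a x t = diffquot g b y t.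
  near=> t; rewrite /diffquot fgx -/(axis a x t) -/(axis b y t) fg //.
  by near: t; exact: steps_in.
suff -> : diffquot f a x @ steps D a x = diffquot g b y @ steps D a x by [].
apply/predeqP => P; split => nP; rewrite /fmap /= in nP *.
  by apply: filterS2 nE nP => t /= <-.
by apply: filterS2 nE nP => t /= ->.
Unshelve. all: by end_near. Qed.

Lemma posdef_unit (A : 'M[R]_m) :
  (forall v : 'rV[R]_m, v != 0 -> 0 < (v *m A *m v^T) 0 0) -> A \in unitmx.
Proof.
move=> Apos; rewrite -row_free_unit -kermx_eq0; apply/negPn/negP => /rowV0Pn[v].
move=> /sub_kermxP vA /Apos; by rewrite vA mul0mx mxE ltxx.
Qed.

End PdTransfer.

Section Cylinder.
Variables (R : realType) (T : topologicalType) (n : nat) (M : atlas R T n) (eps : R).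
Hypotheses (eps_gt0 : 0 < eps) (MM : is_manifold M).
Let A := Mplus M eps.
Let o : 'I_(1 + n) := lshift n ord0.
Implicit Types (i j : idx M) (y z : 'rV[R]_(1 + n)) (p q : R * T).

Lemma domA i p : dom A i p <-> 0 <= p.1 < eps /\ dom M i p.2.
Proof. by rewrite /A /Mplus /cyl /= in_itv. Qed.

Lemma coordo i p : Defs.coord A i p 0 o = p.1.
Proof. by rewrite /A /= row_mxEl mxE. Qed.

Lemma rsub_coord i p : rsubmx (Defs.coord A i p) = Defs.coord M i p.2.
Proof. by rewrite /A /= row_mxKr. Qed.

Lemma rcoordE y : rcoord y = y 0 o.
Proof. by rewrite /rcoord mxE. Qed.

Lemma row_split y : row_mx (const_mx (y 0 o)) (rsubmx y) = y.
Proof.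
rewrite -[RHS]hsubmxK; congr row_mx; apply/rowP => k.
by rewrite !mxE ord1; congr (y _ _); apply: val_inj.
Qed.

Lemma paramM i x : img M i x -> dom M i (param M i x) /\ Defs.coord M i (param M i x) = x.
Proof.
have [_ _ _ /(_ i)[_ _ pK _ _] _] := MM.
by move=> [p dp <-]; rewrite pK.
Qed.

Lemma imgA i y : img A i y <-> 0 <= y 0 o < eps /\ img M i (rsubmx y).
Proof.
split=> [[p /domA[p1 p2] <-]|[y0 yM]].
  by rewrite coordo rsub_coord; split=> //; exists p.2.
have [d1 d2] := paramM yM.
exists (y 0 o, param M i (rsubmx y)); first exact/domA.
by rewrite /A /= d2 row_split.
Qed.

Lemma paramA1 i y : (param A i y).1 = y 0 o. Proof. by rewrite /A /= mxE. Qed.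

Lemma paramA i y : img A i y -> dom A i (param A i y) /\ Defs.coord A i (param A i y) = y.
Proof.
move=> /imgA[y0 yM]; have [d1 d2] := paramM yM; split.
  by apply/domA; rewrite paramA1.
by rewrite /A /= d2 mxE -/o row_split.
Qed.

Lemma coordAK i p : dom A i p -> param A i (Defs.coord A i p) = p.
Proof.
have [_ _ _ /(_ i)[_ _ pK _ _] _] := MM.
move=> /domA[p1 p2]; have := paramA1 i (Defs.coord A i p); rewrite coordo.
rewrite /A /= row_mxKr pK // => ->; by case: p {p1 p2}.
Qed.

Lemma coordA_img i p : dom A i p -> img A i (Defs.coord A i p).
Proof. by exists p. Qed.

Lemma ptsA p : pts A p <-> 0 <= p.1 < eps.
Proof.
split=> [[i /domA[]]//|p0]; have [_ _ ptM _ _] := MM.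
have [i ip] : pts M p.2 by rewrite ptM.
by exists i; exact/domA.
Qed.

Lemma rsubmx_nbhs (y : 'rV[R]_(1 + n)) (B : set 'rV[R]_n) :
  nbhs (rsubmx y) B -> nbhs y (fun z => B (rsubmx z)).
Proof.
move=> /nbhs_ballP[e /= e0 eB]; apply/nbhs_ballP; exists e => //= z.
by move=> /(ball_rowP _ _ e0) yz; apply: eB; apply/ball_rowP => // k; rewrite !mxE.
Qed.

Lemma coord_lt_nbhs y (c : R) : y 0 o < c -> nbhs y (fun z : 'rV[R]_(1 + n) => z 0 o < c).
Proof.
move=> yc; have cy : (fun z : 'rV[R]_(1 + n) => z 0 o) @ y --> y 0 o by exact: coord_continuous.
exact: (cvgr_lt (y 0 o) cy c yc).
Qed.

Lemma coord_gt_nbhs y (c : R) : c < y 0 o -> nbhs y (fun z : 'rV[R]_(1 + n) => c < z 0 o).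
Proof.
move=> yc; have cy : (fun z : 'rV[R]_(1 + n) => z 0 o) @ y --> y 0 o by exact: coord_continuous.
exact: (cvgr_gt (y 0 o) cy c yc).
Qed.

Lemma imgA_hopen i : hopen o (img A i).
Proof.
move=> y yA; have /imgA[/andP[y0 ye] yM] := yA; split=> //.
have [_ _ _ /(_ i)[_ oM _ _ _] _] := MM.
have H1 := rsubmx_nbhs (open_nbhs_nbhs (conj oM yM)).
apply: filterS2 H1 (coord_lt_nbhs ye) => z zM ze z0.
by apply/imgA; rewrite z0.
Qed.

Section RepDom.
Variables (k : R * T -> R * T) (i j : idx M).
Hypotheses (kpts : forall p, pts A p -> pts A (k p)).
Hypothesis ksm : smooth_map A A k.

(** One-sided calculus needs the domain of a chart representation to be relatively open in the
    half-space; this follows from continuity of [k] and of the parametrizations of $M$. *)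
Lemma repA_hopen : hopen o (rep_dom A A k i j).
Proof.
move=> y [yA dk]; have [y0 nA] := imgA_hopen yA; split=> //.
have /imgA[y0e yM] := yA.
have [_ _ _ cM _] := MM; have [_ oM _ _ pc] := cM i; have [od _ _ _ _] := cM j.
pose p := param A i y; have pA : pts A p by exists i; have [] := paramA yA.
have kc : k q @[q --> within (pts A) (nbhs p)] --> k p.
  by have [/subspace_continuousP kc _] := ksm; exact: kc.
have /domA[_ dk2] := dk.
have nk : nbhs (k p) (fun q => dom M j q.2).
  have : nbhs (k p).2 (dom M j) by apply: open_nbhs_nbhs.
  move=> H; exists (setT, dom M j) => /=; last by move=> q [].
  by split=> //; exact: filterT.
have nk' : nbhs p (fun q => pts A q -> dom M j (k q).2) by exact: kc nk.
have nz : nbhs y (fun z => img M i (rsubmx z) -> pts A (param A i z) -> dom M j (k (param A i z)).2).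
  have [[B1 B2] /= [nB1 nB2] Bk] := nk'.
  have cp : param M i x @[x --> within (img M i) (nbhs (rsubmx y))] --> param M i (rsubmx y).
    by move/subspace_continuousP : pc; exact.
  have nB2' : nbhs (rsubmx y) (fun x => img M i x -> B2 (param M i x)) by exact: cp nB2.
  have nB1' : nbhs y (fun z => B1 (param A i z).1).
    have cy : (fun z : 'rV[R]_(1 + n) => z 0 o) @ y --> y 0 o by exact: coord_continuous.
    have nB : nbhs (y 0 o) B1 by rewrite -(paramA1 i y).
    have H : nbhs y (fun z : 'rV[R]_(1 + n) => B1 (z 0 o)) by exact: cy nB.
    by apply: filterS H => z; rewrite (paramA1 i z).
  apply: filterS2 nB1' (rsubmx_nbhs nB2') => z z1 z2 zM; apply: Bk; split=> //.
  exact: z2.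
apply: filterS2 nA nz => z zA zk z0; have zi := zA z0; split=> //.
have [dz _] := paramA zi; have pz : pts A (param A i z) by exists i.
have /ptsA kz := kpts pz; apply/domA; split=> //; apply: zk => //.
by have /imgA[] := zi.
Qed.

Lemma repA_local : locally_eq (img A i) (rep_dom A A k i j).
Proof.
move=> y Dy; have [_ nD] := repA_hopen Dy; apply: filterS nD => z zD; split=> [zi|[]//].
by apply: zD; have [] := imgA_hopen zi.
Qed.

End RepDom.

End Cylinder.

(** The hypothesis is $\hat g_+ = \kappa^*g_+$ at a point, with [J'] the Jacobian of $\kappa$.
    Conjugating by the inverse Jacobian [J] turns it round, and the factors $r^{-2}$ and $f^{-2}$
    combine to $\rho^2$. *)
Lemma pullback_inverse (K : fieldType) m (J J' G G' : 'M[K]_m) (r f : K) :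
  r != 0 -> f != 0 -> J *m J' = 1%:M -> f ^- 2 *: G' = J' *m (r ^- 2 *: G) *m J'^T ->
  J *m G' *m J^T = (f / r) ^+ 2 *: G.
Proof.
move=> r0 f0 JJ' H.
have -> : G' = f ^+ 2 *: (J' *m (r ^- 2 *: G) *m J'^T).
  by rewrite -H scalerA mulfV ?scale1r // expf_neq0.
have J'JT : J'^T *m J^T = 1%:M by rewrite -trmx_mul JJ' trmx1.
rewrite -scalemxAr -scalemxAl !mulmxA JJ' mul1mx -mulmxA J'JT mulmx1 scalerA.
by congr (_ *: _); field.
Qed.

(** * The conjugation formula in a pair of charts *)

Section Main.
Variables (R : realType) (T : topologicalType) (n : nat) (M : atlas R T n) (eps : R).
Hypotheses (n0 : (0 < n)%N) (eps_gt0 : 0 < eps) (MM : is_manifold M).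
Let A := Mplus M eps.
Let o : 'I_(1 + n) := lshift n ord0.

Lemma metric_sym (g : tensor2 M) i x : is_metric g -> img M i x -> (g i x)^T = g i x.
Proof. by move=> [_ H _ _]; exact: H. Qed.

Lemma metric_unit (g : tensor2 M) i x : is_metric g -> img M i x -> g i x \in unitmx.
Proof. by move=> [_ _ H _] xi; apply: posdef_unit; exact: H. Qed.

(** The substitution $s = n-\lambda-1$ gives $-(2\lambda-n+1) = 2s-n+1$ and $-(\lambda-n+1) = s$,
    which is the natural form used in [shift_identity]. *)
Lemma shift_opE (hr : R -> tensor2 M) i lam (u : R * T -> R[i]) p : dom A i p ->
  let y := Defs.coord A i p in
  let U z := u (param A i z) in
  let s := n%:R - lam - 1 in
  shift_op eps hr i lam u p =
  (y 0 o)%:C * clap (img A i) (@radial R n \o hcomp hr i) U y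
  + (2 * s - n%:R + 1) * cpd (img A i) o U y
  + s * (2^-1 * \tr (invmx (hcomp hr i y) *m
       \matrix_(a, b) pd (img A i) o (fun z => hcomp hr i z a b) y))%:C * U y.
Proof.
move=> pi y U s; rewrite /U coordAK // coordo /shift_op -/A.
have s1 : 2 * s - n%:R + 1 = - (2 * lam - n%:R + 1) by rewrite /s; ring.
rewrite s1 rmorphM fmorphV rmorph_nat mulNr.
have -> (t : R[i]) : s * (2^-1 * t) = - (2^-1 * (lam - n%:R + 1) * t) by rewrite /s; ring.
by rewrite mulNr.
Qed.

(** The exponents add up to 0: the outer power in the theorem is the inverse of the factor
    $\rho\cdot\rho^s$ produced by the conjugation. *)
Lemma cpow_cancel (r : R) (lam N : R[i]) : 0 < r ->
  cpow r (lam - N) * (r%:C * cpow r (N - lam - 1)) = 1.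
Proof.
move=> r0; rewrite -(cpow1 r0) -!cpowD (_ : _ + _ = 0) ?cpow0 //; ring.
Qed.

Variables (h hconf : tensor2 M) (hr hhatr : R -> tensor2 M) (kappa kappa' : R * T -> R * T).
Hypothesis g_poincare : even_poincare eps hr h.
Hypothesis ghat_poincare : even_poincare eps hhatr hconf.
Hypothesis kappa_diffeo : diffeo A kappa kappa'.
Hypothesis kappa_id : forall x : T, kappa (0, x) = (0, x).
Hypothesis ghat_pullback : is_pullback (Mplus0 M eps) kappa (gplus eps hr) (gplus eps hhatr).

Let kpts p : pts A p -> pts A (kappa p). Proof. by have [H _ _ _] := kappa_diffeo; move=> /H[]. Qed.
Let kpts' p : pts A p -> pts A (kappa' p). Proof. by have [_ H _ _] := kappa_diffeo; move=> /H[]. Qed.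
Let kK p : pts A p -> kappa' (kappa p) = p. Proof. by have [H _ _ _] := kappa_diffeo; move=> /H[]. Qed.
Let kK' p : pts A p -> kappa (kappa' p) = p. Proof. by have [_ H _ _] := kappa_diffeo; move=> /H[]. Qed.
Let ksm : smooth_map A A kappa. Proof. by have [] := kappa_diffeo. Qed.
Let ksm' : smooth_map A A kappa'. Proof. by have [] := kappa_diffeo. Qed.

Let pts0 x : pts A (0, x).
Proof. by apply/(ptsA eps MM); rewrite /= lexx. Qed.

Let kappa'_id x : kappa' (0, x) = (0, x).
Proof. by rewrite -{1}kappa_id (kK (pts0 x)). Qed.

(** If [kappa' p] had $r=0$, it would be fixed by [kappa], so [p] itself would lie on the
    boundary. *)
Let kappa'_gt0 p : pts A p -> 0 < p.1 -> 0 < (kappa' p).1.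
Proof.
move=> pA p1; have /(ptsA eps MM) /andP[ge0 _] := kpts' pA.
rewrite lt_neqAle ge0 // andbT; apply/eqP => k0; have := kK' pA.
by rewrite [kappa' p]surjective_pairing -k0 kappa_id => pE; rewrite -pE ltxx in p1.
Qed.

Let kappa_gt0 p : pts A p -> 0 < p.1 -> 0 < (kappa p).1.
Proof.
move=> pA p1; have /(ptsA eps MM) /andP[ge0 _] := kpts pA.
rewrite lt_neqAle ge0 // andbT; apply/eqP => k0; have := kK pA.
by rewrite [kappa p]surjective_pairing -k0 kappa'_id => pE; rewrite -pE ltxx in p1.
Qed.

Section Charts.
Variables (i j : idx M).
Let D := rep_dom A A kappa' j i.
Let F := rep A A kappa' j i.
Let hD : hopen o D. Proof. exact: (repA_hopen MM kpts' ksm'). Qed.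
Let locD : locally_eq (img A j) D. Proof. exact: (repA_local MM kpts' ksm'). Qed.

Let dF y : D y -> dom A i (kappa' (param A j y)). Proof. by case. Qed.

Let FD y : D y -> img A i (F y).
Proof. by move=> /dF; exact: coordA_img. Qed.

Let paramF y : D y -> param A i (F y) = kappa' (param A j y).
Proof. by move=> /dF; exact: (coordAK MM). Qed.

Let Fo y : F y 0 o = (kappa' (param A j y)).1.
Proof. exact: coordo. Qed.

Let ptsD y : D y -> pts A (param A j y).
Proof. by move=> [yA _]; exists j; have [] := paramA MM yA. Qed.

Let Fpos y : D y -> 0 < y 0 o -> 0 < F y 0 o.
Proof.
move=> Dy y0; rewrite Fo; apply: kappa'_gt0; first exact: ptsD.
by rewrite (paramA1 eps j).
Qed.

Let param0 (y : 'rV[R]_(1 + n)) : y 0 o = 0 -> param A j y = (0, param M j (rsubmx y)).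
Proof. by move=> y0; have := paramA1 eps j y; rewrite y0 /A /= => ->. Qed.

Let F0 y : D y -> y 0 o = 0 -> F y 0 o = 0.
Proof. by move=> Dy y0; rewrite Fo param0 // kappa'_id. Qed.

Let Fsm k b : Ck k D (fun y => F y 0 b).
Proof. by have [_ H] := ksm'; exact: (H j i b k). Qed.

Let metric_hr y : img A j y -> is_metric (hr (y 0 o)).
Proof. by have [H _ _ _ _] := g_poincare; move=> /(imgA eps MM)[y0 _]; exact: H. Qed.

Let metric_hhatr y : img A i y -> is_metric (hhatr (y 0 o)).
Proof. by have [H _ _ _ _] := ghat_poincare; move=> /(imgA eps MM)[y0 _]; exact: H. Qed.

Let hcompE (g : R -> tensor2 M) k y : hcomp g k y = g (y 0 o) k (rsubmx y).
Proof. by rewrite /hcomp rcoordE. Qed.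

Let hU y : D y -> hcomp hr j y \in unitmx.
Proof.
move=> [yA _]; have /(imgA eps MM)[_ yM] := yA; rewrite hcompE.
exact: metric_unit (metric_hr yA) yM.
Qed.

Let hT y : D y -> (hcomp hr j y)^T = hcomp hr j y.
Proof.
move=> [yA _]; have /(imgA eps MM)[_ yM] := yA; rewrite hcompE.
exact: metric_sym (metric_hr yA) yM.
Qed.

Let hhU y : img A i y -> hcomp hhatr i y \in unitmx.
Proof.
move=> yA; have /(imgA eps MM)[_ yM] := yA; rewrite hcompE.
exact: metric_unit (metric_hhatr yA) yM.
Qed.

Let hhT y : img A i y -> (hcomp hhatr i y)^T = hcomp hhatr i y.
Proof.
move=> yA; have /(imgA eps MM)[_ yM] := yA; rewrite hcompE.
exact: metric_sym (metric_hhatr yA) yM.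
Qed.

Let hsm k a b : Ck k D (fun y => hcomp hr j y a b).
Proof.
have [_ H _ _ _] := g_poincare; apply: (Ck_local locD) (H j a b k) => //.
Qed.

Let hhsm k a b : Ck k (img A i) (fun y => hcomp hhatr i y a b).
Proof. by have [_ H _ _ _] := ghat_poincare; exact: (H i a b k). Qed.

(** The chain rule for [f \o F], which is the identity on [D]. *)
Let jac_inverse y : D y -> 0 < y 0 o ->
  Defs.jacobian D F y *m Defs.jacobian (rep_dom (Mplus0 M eps) (Mplus0 M eps) kappa i j)
    (rep (Mplus0 M eps) (Mplus0 M eps) kappa i j) (F y) = 1%:M.
Proof.
move=> Dy y0; pose Dk := rep_dom A A kappa i j; pose f := rep A A kappa i j.
have hDk : hopen o Dk := repA_hopen MM kpts ksm.
have fF w : D w -> f (F w) = w.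
  move=> Dw; rewrite /f /rep -/(F w) paramF // (kK' (ptsD Dw)).
  by have [wA _] := Dw; have [] := paramA MM wA.
have FDk w : D w -> Dk (F w).
  move=> Dw; split; first exact: FD.
  rewrite paramF // (kK' (ptsD Dw)); have [wA _] := Dw; by have [] := paramA MM wA.
have fsm b : Ck 1 Dk (fun z => f z 0 b) by have [_ H] := ksm; exact: (H i j b 1%N).
(* The pull-back hypothesis refers to charts of the open cylinder, smoothness to those of $M_+$.
   Near a point with $r>0$ the two domains agree, hence so do the Jacobians. *)
have loc0 : \forall z \near F y, rep_dom (Mplus0 M eps) (Mplus0 M eps) kappa i j z <-> Dk z.
  have Fy0 := Fpos Dy y0; apply: filterS (coord_gt_nbhs Fy0) => z z0; split.
    move=> [[p [p1 p2] pz] [q1 q2]]; rewrite /= !in_itv /= in p1 q1.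
    split; first by exists p => //; apply/domA; split=> //; case/andP: p1 => /ltW -> ->.
    by apply/domA; split=> //; case/andP: q1 => /ltW q11 q12; exact/andP.
  move=> [zA zk]; have /(imgA eps MM)[/andP[_ ze] zM] := zA; have [d1 d2] := paramA MM zA.
  split.
    exists (param A i z) => //; have /domA[d3 d4] := d1; split=> //.
    by rewrite /= in_itv /= mxE; apply/andP; split.
  have /domA[/andP[k1 k2] k3] := zk; split=> //; rewrite /= in_itv /=; apply/andP; split=> //.
  apply: kappa_gt0; first by exists i.
  by rewrite (paramA1 eps i).
apply/matrixP => a b; rewrite mxE [RHS]mxE.
have P := hopen_proper a hD Dy.
have := has_pd_chain hDk (fsm b) Dy FDk (fun k => Ck_has_pd (a := a) (Fsm 1 k) Dy).
move=> /(has_pd_near Dy) H; have {}H := has_pd_pd P (H (fun w => w 0 b) _).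
rewrite eq_sym -(has_pd_pd P (@has_pd_coord R _ D a b y)) H; last first.
  by near=> w => Dw; rewrite /= fF.
apply: eq_bigr => k _; rewrite !mxE mulrC; congr (_ * _); exact: pd_steps.
Unshelve. all: by end_near. Qed.

Let Fh y : D y -> 0 < y 0 o ->
  Defs.jacobian D F y *m radial (hcomp hhatr i (F y)) *m (Defs.jacobian D F y)^T
  = (F y 0 o / y 0 o) ^+ 2 *: radial (hcomp hr j y).
Proof.
move=> Dy y0; have Fy0 := Fpos Dy y0.
apply: (pullback_inverse _ _ (jac_inverse Dy y0)); rewrite ?gt_eqF //.
have /(imgA eps MM)[/andP[_ Fe] FM] := FD Dy; have [yA yk] := Dy.
have [py1 py2] := paramA MM yA; have [d1 d2] := paramM MM FM.
have fFy : rep (Mplus0 M eps) (Mplus0 M eps) kappa i j (F y) = y.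
  rewrite /rep; have := paramF Dy; rewrite /A /= => ->; rewrite (kK' (ptsD Dy)) //.
have H : rep_dom (Mplus0 M eps) (Mplus0 M eps) kappa i j (F y).
  split.
    exists (F y 0 o, param M i (rsubmx (F y))); first by split=> //; rewrite /= in_itv /= Fy0.
    by rewrite /= d2 row_split.
  have := paramF Dy; rewrite /A /= => ->; rewrite (kK' (ptsD Dy)) //.
  have /domA[y1 y2] := py1; split=> //; rewrite /= in_itv /= mxE; apply/andP; split; first exact: y0.
  by have /(imgA eps MM)[/andP[]] := yA.
have := ghat_pullback H; rewrite fFy /gplus !rcoordE; exact.
Qed.

Let rsub_axis (y : 'rV[R]_(1 + n)) a t : rsubmx (axis (rshift 1 a) y t) = axis a (rsubmx y) t.
Proof.
by apply/rowP => b; rewrite mxE !axisE mxE; congr (_ + _%:R * _).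
Qed.

(** On $r=0$ the map $\kappa^{-1}$ is the identity, so the tangential block is the Jacobian of a
    chart transition of $M$. It is invertible because it relates the nondegenerate components of
    [hhatr 0] in the two charts. *)
Let JU y : D y -> y 0 o = 0 -> drsubmx (Defs.jacobian D F y) \in unitmx.
Proof.
move=> Dy y0; pose x := rsubmx y.
have m0 : is_metric (hhatr 0).
  by have [H _ _ _ _] := ghat_poincare; apply: H; rewrite lexx.
have axis_o a t : axis (rshift 1 a) y t 0 o = 0.
  by rewrite axisE y0 add0r /o eq_lrshift mul0r.
have Dax a t : D (axis (rshift 1 a) y t) <-> rep_dom M M id j i (axis a x t).
  have e := param0 (axis_o a t).
  have -> : D (axis (rshift 1 a) y t) = (img A j (axis (rshift 1 a) y t) /\
    dom A i (kappa' (param A j (axis (rshift 1 a) y t)))) by [].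
  rewrite e kappa'_id rsub_axis.
  split=> [[/(imgA eps MM)[_ t1] /domA[_ t2]]|[t1 t2]]; first by rewrite rsub_axis in t1.
  split; last by apply/domA; rewrite /= lexx eps_gt0.
  by apply/(imgA eps MM); rewrite axis_o lexx eps_gt0 rsub_axis.
have Dx : rep_dom M M id j i x.
  split; first by have [/(imgA eps MM)[]] := Dy.
  by have [_] := Dy; rewrite param0 // kappa'_id => /domA[].
have [_ _ _ /(_ j i x Dx)] := m0; set J := Defs.jacobian _ _ _ => HJ.
have : hhatr 0 j x \in unitmx by apply: (metric_unit m0); case: Dx.
rewrite HJ !unitmx_mul => /andP[/andP[JUx _] _].
rewrite (_ : drsubmx _ = J) //; apply/matrixP => a b; rewrite !mxE.
apply: pd_transfer => // t Dt; rewrite /F /rep (param0 (axis_o a t)) kappa'_id.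
by rewrite /A /= row_mxEr rsub_axis.
Qed.

(** Evenness at lowest order: for index 0, [k.*2.+1] is 1, so the first $r$-derivative vanishes on
    the boundary. *)
Let trace0 (g : R -> tensor2 M) (h0 : tensor2 M) k (y : 'rV[R]_(1 + n)) : even_poincare eps g h0 ->
  img A k y -> y 0 o = 0 -> \matrix_(a, b) pd (img A k) o (fun z => hcomp g k z a b) y = 0.
Proof.
move=> [_ _ _ H _] yA y0; apply/matrixP => a b; rewrite [RHS]mxE mxE.
have /(imgA eps MM)[_ yM] := yA; have := H k (rsubmx y) a b 0%N yM.
rewrite (_ : bdry _ = y) // -[RHS]row_split y0; congr row_mx.
Qed.

Variables (lam : R[i]) (u : R * T -> R[i]).
Hypothesis u_smooth : smooth_cfun A u.
Let rho := div_r (fst \o kappa').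
Let s : R[i] := n%:R - lam - 1.
Let W q := cpow (rho q) s * u (kappa' q).
Let U z := u (param A i z).

Let Usm1 k : Ck k (img A i) (fun z => complex.Re (U z)).
Proof. by have [H _] := u_smooth; exact: (H i k). Qed.

Let Usm2 k : Ck k (img A i) (fun z => complex.Im (U z)).
Proof. by have [_ H] := u_smooth; exact: (H i k). Qed.

Let WE z : D z -> W (param A j z) = cpow (rho (param A j z)) s * U (F z).
Proof. by move=> Dz; rewrite /W /U paramF. Qed.

Let rhoE (z : 'rV[R]_(1 + n)) : 0 < z 0 o -> rho (param A j z) = F z 0 o / z 0 o.
Proof.
by move=> z0; rewrite /rho /div_r (paramA1 eps j) gt_eqF // Fo.
Qed.

(** The part of [D] where [rho] is an honest quotient and points are interior. Locality of
    derivatives allows the operator to be computed there instead of in the chart domain. *)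
Let D0 := D `&` [set z : 'rV[R]_(1 + n) | 0 < z 0 o].

Let nbhs_D0 z : D0 z -> nbhs z D0.
Proof.
move=> [Dz z0]; have [_ nD] := hD Dz.
by apply: filterS2 nD (coord_gt_nbhs z0) => w wD w0; split=> //; apply: wD; exact: ltW.
Qed.

Let hD0 : hopen o D0.
Proof.
move=> z D0z; split; first by have [_ /ltW] := D0z.
by apply: filterS (nbhs_D0 D0z) => w D0w _.
Qed.

Let locDD0 : locally_eq D D0.
Proof. by move=> z /nbhs_D0 nD; apply: filterS nD => w D0w; split=> // _; have [] := D0w. Qed.

Let loc_img_D0 : locally_eq (img A j) D0.
Proof.
move=> z /nbhs_D0 nD; apply: filterS nD => w D0w; split=> // _.
by have [[]] := D0w.
Qed.

Let interior y : D y -> 0 < y 0 o ->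
  (y 0 o)%:C * clap (img A j) (@radial R n \o hcomp hr j) (W \o param A j) y
  + (2 * s - n%:R + 1) * cpd (img A j) o (W \o param A j) y
  + s * (2^-1 * \tr (invmx (hcomp hr j y) *m
       \matrix_(a, b) pd (img A j) o (fun z => hcomp hr j z a b) y))%:C * W (param A j y) =
  (rho (param A j y))%:C * cpow (rho (param A j y)) s * (
  (F y 0 o)%:C * clap (img A i) (@radial R n \o hcomp hhatr i) U (F y)
  + (2 * s - n%:R + 1) * cpd (img A i) o U (F y)
  + s * (2^-1 * \tr (invmx (hcomp hhatr i (F y)) *m
       \matrix_(a, b) pd (img A i) o (fun z => hcomp hhatr i z a b) (F y)))%:C * U (F y)).
Proof.
move=> Dy y0; have D0y : D0 y by [].
pose v z := cpow (F z 0 o / z 0 o) s * U (F z).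
have Wv : {in D0, W \o param A j =1 v}.
  by move=> z; rewrite inE => -[Dz z0]; rewrite /= WE // rhoE.
have Wv1 : {in D0, (fun z => complex.Re (W (param A j z))) =1 (fun z => complex.Re (v z))}.
  by move=> z /Wv /= ->.
have Wv2 : {in D0, (fun z => complex.Im (W (param A j z))) =1 (fun z => complex.Im (v z))}.
  by move=> z /Wv /= ->.
have -> : clap (img A j) (@radial R n \o hcomp hr j) (W \o param A j) y =
    clap D0 (@radial R n \o hcomp hr j) v y.
  by rewrite /clap (laplacian_local _ loc_img_D0 Wv1) // (laplacian_local _ loc_img_D0 Wv2).
have -> : cpd (img A j) o (W \o param A j) y = cpd D0 o v y.
  by rewrite /cpd (pd_local o loc_img_D0 Wv1) // (pd_local o loc_img_D0 Wv2).
have -> : \matrix_(a, b) pd (img A j) o (fun z => hcomp hr j z a b) y =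
    \matrix_(a, b) pd D0 o (fun z => hcomp hr j z a b) y.
  by apply/matrixP => a b; rewrite !mxE; apply: pd_local.
have -> : W (param A j y) = v y by apply: Wv; rewrite inE.
rewrite rhoE //; apply: interior_identity => //.
- exact: imgA_hopen.
- by move=> z [Dz _]; exact: FD.
- by move=> z [].
- by move=> z [Dz z0]; exact: Fpos.
- by move=> b; apply: (Ck_local locDD0) (Fsm 2 b).
- by move=> a b; apply: (Ck_local locDD0) (hsm 1 a b).
- by move=> z [Dz _]; exact: hU.
- by move=> z [Dz _]; exact: hT.
- move=> z D0z; have [Dz z0] := D0z; rewrite -Fh //.
  suff -> : Defs.jacobian D0 F z = Defs.jacobian D F z by [].
  by apply/matrixP => a b; rewrite !mxE; apply/esym/pd_local.
Qed.

(** As [f] vanishes at $r=0$, the limit in [div_r] is that of its difference quotients in $r$ along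
    right-hand steps. *)
Let rho_bdry y : D y -> y 0 o = 0 -> rho (param A j y) = pd D o (fun w => F w 0 o) y.
Proof.
move=> Dy y0; rewrite /rho /div_r (paramA1 eps j) y0 eqxx; apply: cvg_lim => //.
have H : has_pd D o (fun w => F w 0 o) y (pd D o (fun w => F w 0 o) y).
  exact: Ck_has_pd (Fsm 1 o) Dy.
have H' : diffquot (fun w => F w 0 o) o y t @[t --> (0 : R)^'+] --> pd D o (fun w => F w 0 o) y.
  move=> B /H HB; exact: (hopen_steps hD Dy HB).
suff E t : diffquot (fun w => F w 0 o) o y t = (fst \o kappa') (t, (param A j y).2) / t.
  by rewrite (_ : (fun t => _) = diffquot (fun w => F w 0 o) o y) //; apply/funext => t.
rewrite /diffquot (F0 Dy y0) subr0 -/(axis o y t) Fo; congr ((kappa' _).1 / _).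
rewrite [LHS]surjective_pairing (paramA1 eps j) axisE eqxx y0 mul1r add0r; congr (_, _).
rewrite /A /=; congr (param M j _); apply/rowP => b.
by rewrite mxE axisE mxE /o eq_rlshift mul0r addr0.
Qed.

Let boundary y : D y -> y 0 o = 0 ->
  cpd (img A j) o (W \o param A j) y =
  cpow (rho (param A j y)) s * (rho (param A j y))%:C * cpd (img A i) o U (F y).
Proof.
move=> Dy y0; pose v z := cpow (rho (param A j z)) s * U (F z).
have Wv1 : {in D, (fun z => complex.Re (W (param A j z))) =1 (fun z => complex.Re (v z))}.
  by move=> z; rewrite inE => Dz; rewrite WE.
have Wv2 : {in D, (fun z => complex.Im (W (param A j z))) =1 (fun z => complex.Im (v z))}.
  by move=> z; rewrite inE => Dz; rewrite WE.
have -> : cpd (img A j) o (W \o param A j) y = cpd D o v y.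
  by rewrite /cpd (pd_local o locD Wv1) // (pd_local o locD Wv2).
have hhF : hcomp hhatr i (F y) \in unitmx by apply/hhU/FD.
apply: (boundary_identity (rho := fun z => rho (param A j z)) n0 hD
  (imgA_hopen MM (i := i)) FD (Fsm 2) (hsm 1) (hhsm 1) Fpos F0 Fh Dy y0 hhF (JU Dy y0)) => //.
- exact: rho_bdry.
- by move=> w _; exact: rhoE.
Qed.

Lemma rho_gt0 y : D y -> 0 < rho (param A j y).
Proof.
move=> Dy; have [] := hD Dy; rewrite le_eqVlt => /orP[/eqP y0|y0] _.
  rewrite rho_bdry //; apply: (boundary_slope_gt0 n0 hD
    (imgA_hopen MM (i := i)) FD (Fsm 2) (hsm 1) (hhsm 1) Fpos F0 Fh Dy) => //.
  - by apply/hhU/FD.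
  - exact: JU.
by rewrite rhoE // divr_gt0 // Fpos.
Qed.

Lemma shift_conjugation p : dom A i p -> dom A j (kappa p) ->
  shift_op eps hhatr i lam u p =
  cpow (rho (kappa p)) (lam - n%:R) * shift_op eps hr j lam W (kappa p).
Proof.
move=> pi kpj; set q := kappa p; pose y := Defs.coord A j q.
have qE : param A j y = q by exact: (coordAK MM).
have pp : pts A p by exists i.
have Dy : D y by split; [exact: coordA_img|rewrite qE kK].
have Fy : F y = Defs.coord A i p by rewrite /F /rep qE kK.
rewrite (shift_opE _ _ _ pi) (shift_opE _ _ _ kpj) -/y -Fy -/q -/s -/U.
(* By [cpow_cancel] it suffices that $S(g_+;\lambda)$ applied to [W] is $\rho^{s+1}$ times the value
   of $S(\hat g_+;\lambda)u$ at the corresponding point. *)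
suff -> : (y 0 o)%:C * clap (img A j) (@radial R n \o hcomp hr j) (W \o param A j) y
  + (2 * s - n%:R + 1) * cpd (img A j) o (W \o param A j) y
  + s * (2^-1 * \tr (invmx (hcomp hr j y) *m
       \matrix_(a, b) pd (img A j) o (fun z => hcomp hr j z a b) y))%:C * W (param A j y) =
  (rho (param A j y))%:C * cpow (rho (param A j y)) s * (
  (F y 0 o)%:C * clap (img A i) (@radial R n \o hcomp hhatr i) U (F y)
  + (2 * s - n%:R + 1) * cpd (img A i) o U (F y)
  + s * (2^-1 * \tr (invmx (hcomp hhatr i (F y)) *m
       \matrix_(a, b) pd (img A i) o (fun z => hcomp hhatr i z a b) (F y)))%:C * U (F y)).
  by rewrite qE mulrA cpow_cancel ?mul1r // -qE rho_gt0.
have [] := hD Dy; rewrite le_eqVlt => /orP[/eqP y0|y0] _; last exact: interior.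
have yA : img A j y by case: Dy.
(* Here $r$ and $f$ both vanish, so both Laplacians drop out whatever their values, and [trace0]
   removes the zeroth-order terms; the common coefficient $2s-n+1$ remains. *)
rewrite boundary // (trace0 g_poincare yA) // (trace0 ghat_poincare (FD Dy)) ?F0 //.
have tr0 : (2^-1 * \tr (0 : 'M[R]_n))%:C = 0 :> R[i] by rewrite mxtrace0 mulr0.
by rewrite -y0 !mulmx0 !tr0 !mulr0 !mul0r !add0r !addr0; ring.
Qed.

End Charts.
End Main.

Unset Implicit Arguments.
Set Strict Implicit.

Theorem theorem1 (R : realType) (T : topologicalType) (n : nat)
  (M : atlas R T n) (h : tensor2 M) (phi : T -> R) (eps : R)
  (hr hhatr : R -> tensor2 M) (kappa kappa' : R * T -> R * T)
  (n_ge3 : (3 <= n)%N)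
  (M_manifold : is_manifold M)
  (h_metric : is_metric h)
  (phi_smooth : smooth_fun M phi)
  (eps_gt0 : 0 < eps)
  (g_poincare : even_poincare eps hr h)
  (kappa_diffeo : diffeo (Mplus M eps) kappa kappa')
  (kappa_id : forall x : T, kappa (0, x) = (0, x))
  (ghat_pullback : is_pullback (Mplus0 M eps) kappa (gplus eps hr) (gplus eps hhatr))
  (ghat_poincare : even_poincare eps hhatr (conformal phi h)) :
  forall lam : R[i],
  let rho := div_r (fst \o kappa') in
  forall (i j : idx M) (u : R * T -> R[i]), smooth_cfun (Mplus M eps) u ->
  forall p : R * T,
    dom (Mplus M eps) i p -> dom (Mplus M eps) j (kappa p) ->
    shift_op eps hhatr i lam u p =
    (pull kappa
     \o mult (fun q => cpow (rho q) (lam - n%:R))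
     \o shift_op eps hr j lam
     \o mult (fun q => cpow (rho q) (n%:R - lam - 1))
     \o pull kappa') u p.
Proof.
move=> lam rho i j u usm p pi pj.
have n_gt0 : (0 < n)%N by exact: leq_trans n_ge3.
exact: (shift_conjugation n_gt0 eps_gt0 M_manifold g_poincare ghat_poincare
  kappa_diffeo kappa_id ghat_pullback lam usm pi pj).
Qed.
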